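(* Let $H^2_{\beta}$ be a weighted Hardy space of polynomial growth. If $\varphi$ is a parabolic disk automorphism, then the spectrum of the composition operator $C_{\varphi}$ acting on $H^2_{\beta}$ is the unit circle $\{z\in\mathbb{C}: |z|=1\}$.
   Context: $\mathbb{D}$ is the open unit disk. Let $w=\{w_k\}_{k\ge1}$ be a sequence of positive numbers with $w_k\to1$, and put $\beta_0=1$, $\beta_k=\prod_{j=1}^k w_j$. The weighted Hardy space $H^2_\beta$ is the Hilbert space of analytic functions $f(z)=\sum_{k\ge0}\widehat f(k)z^k$ on $\mathbb{D}$ with $\|f\|_{H^2_\beta}^2=\sum_{k\ge0}|\widehat f(k)|^2\beta_k^2<\infty$. It is of polynomial growth if $\sup_k (k+1)|w_k-1|<\infty$. A disk automorphism is an analytic bijection $\mathbb{D}\to\mathbb{D}$, i.e. a map $z\mapsto e^{i\theta}\frac{z_0-z}{1-\overline{z_0}z}$ with $z_0\in\mathbb{D}$; it is parabolic if it has just one fixed point, of multiplicity $2$, and this point lies on the unit circle. $C_\varphi f=f\circ\varphi$. *)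

(* Defs.v *)
From Stdlib Require Import Reals Lra Lia.
From Stdlib Require Import FunctionalExtensionality ProofIrrelevance.
From Coquelicot Require Import Coquelicot.

Open Scope R_scope.

(* The weight sequence is indexed from 1; the value [w 0] is never used. *)
Record weight : Type := Weight {
  weight_fun :> nat -> R;
  weight_pos : forall k, (1 <= k)%nat -> 0 < weight_fun k;
  weight_lim : is_lim_seq weight_fun 1
}.

Fixpoint beta (w : nat -> R) (k : nat) : R :=
  match k with
  | O => 1
  | S j => beta w j * w (S j)
  end.

Definition polynomial_growth (w : nat -> R) : Prop :=
  exists M : R, forall k, (1 <= k)%nat -> (INR k + 1) * Rabs (w k - 1) <= M.

Lemma beta_pos (w : weight) (k : nat) : 0 < beta w k.
Proof.
induction k as [|k IH]; simpl; [lra|].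
apply Rmult_lt_0_compat; [exact IH|]. apply weight_pos; lia.
Qed.

Definition disk : Type := {z : C | Cmod z < 1}.

Definition disk_val (z : disk) : C := proj1_sig z.
Coercion disk_val : disk >-> C.

(* [f] is analytic on the disk, with Taylor coefficients [a] at the origin. *)
Definition taylor (f : disk -> C) (a : nat -> C) : Prop :=
  forall z : disk, @is_pseries C_AbsRing C_NormedModule a (disk_val z) (f z).

(* The Taylor coefficients are carried along with the function, but they are
   determined by it: see [hardy_ext]. *)
Record hardy (w : weight) : Type := Hardy {
  hardy_fun :> disk -> C;
  hardy_coef : nat -> C;
  hardy_taylor : taylor hardy_fun hardy_coef;
  hardy_summable : ex_series (fun k => (Cmod (hardy_coef k))^2 * (beta w k)^2)
}.

Arguments Hardy {w}.
Arguments hardy_fun {w}.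
Arguments hardy_coef {w}.
Arguments hardy_taylor {w}.
Arguments hardy_summable {w}.

Definition hardy_norm {w : weight} (f : hardy w) : R :=
  sqrt (Series (fun k => (Cmod (hardy_coef f k))^2 * (beta w k)^2)).

Lemma is_series_fst (u : nat -> C) (l : C) :
  @is_series C_AbsRing C_NormedModule u l ->
  is_series (fun k => fst (u k)) (fst l).
Proof.
intros H.
apply filterlim_ext with (fun n => fst (@sum_n C_AbelianMonoid u n)).
{ intros n. induction n as [|n IH].
  - rewrite !sum_O. reflexivity.
  - rewrite !sum_Sn. rewrite <- IH. reflexivity. }
eapply filterlim_comp; [exact H|].
intros P [e He]. exists e. intros y Hy. apply He. apply Hy.
Qed.

Lemma is_series_snd (u : nat -> C) (l : C) :
  @is_series C_AbsRing C_NormedModule u l ->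
  is_series (fun k => snd (u k)) (snd l).
Proof.
intros H.
apply filterlim_ext with (fun n => snd (@sum_n C_AbelianMonoid u n)).
{ intros n. induction n as [|n IH].
  - rewrite !sum_O. reflexivity.
  - rewrite !sum_Sn. rewrite <- IH. reflexivity. }
eapply filterlim_comp; [exact H|].
intros P [e He]. exists e. intros y Hy. apply He. apply Hy.
Qed.

Lemma pow_n_RtoC (x : R) (k : nat) :
  @pow_n C_AbsRing (RtoC x) k = RtoC (x ^ k).
Proof.
induction k as [|k IH]; [reflexivity|].
simpl. rewrite IH. unfold mult; simpl. now rewrite RtoC_mult.
Qed.

Lemma pow_n_Rpow (x : R) (k : nat) : @pow_n R_AbsRing x k = x ^ k.
Proof.
induction k as [|k IH]; [reflexivity|].
simpl. rewrite IH. reflexivity.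
Qed.

Lemma taylor_real (f : disk -> C) (a : nat -> C) (x : R) (Hx : Cmod (RtoC x) < 1) :
  taylor f a ->
  is_pseries (fun k => fst (a k)) x (fst (f (exist _ (RtoC x) Hx))) /\
  is_pseries (fun k => snd (a k)) x (snd (f (exist _ (RtoC x) Hx))).
Proof.
intros H. specialize (H (exist _ (RtoC x) Hx)).
split.
- apply is_series_ext with (2 := is_series_fst _ _ H). intros k.
  cbn [disk_val proj1_sig]. rewrite (pow_n_RtoC x k), (pow_n_Rpow x k).
  unfold scal; simpl; unfold mult; simpl. ring.
- apply is_series_ext with (2 := is_series_snd _ _ H). intros k.
  cbn [disk_val proj1_sig]. rewrite (pow_n_RtoC x k), (pow_n_Rpow x k).
  unfold scal; simpl; unfold mult; simpl. ring.
Qed.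

Lemma CV_radius_half (a : nat -> R) (l : R) :
  is_pseries a (1/2) l -> Rbar_lt 0 (CV_radius a).
Proof.
intros H.
assert (B : Rbar_le (Rabs (1/2)) (CV_radius a)).
{ destruct (Rbar_le_dec (Rabs (1/2)) (CV_radius a)) as [?|n]; [assumption|].
  apply Rbar_not_le_lt in n.
  exfalso. apply (CV_disk_outside a (1/2) n).
  apply ex_series_lim_0. exists l.
  apply is_series_ext with (2 := H). intros k.
  rewrite (pow_n_Rpow (1/2) k). unfold scal; simpl; unfold mult; simpl. ring. }
eapply Rbar_lt_le_trans; [|exact B]. simpl.
rewrite Rabs_pos_eq; lra.
Qed.

Lemma taylor_unique (f : disk -> C) (a b : nat -> C) :
  taylor f a -> taylor f b -> forall k, a k = b k.
Proof.
intros Ha Hb k.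
assert (Hx : forall x, Rabs x < 1 -> Cmod (RtoC x) < 1)
  by (intros x; rewrite Cmod_R; auto).
assert (Hh : Rabs (1/2) < 1) by (rewrite Rabs_pos_eq; lra).
assert (L : locally 0 (fun x => Rabs x < 1)).
{ exists (mkposreal 1 Rlt_0_1). intros y Hy.
  unfold ball in Hy; simpl in Hy; unfold AbsRing_ball, abs, minus, plus, opp in Hy; simpl in Hy.
  now rewrite Ropp_0, Rplus_0_r in Hy. }
destruct (taylor_real f a (1/2) (Hx _ Hh) Ha) as [A1 A2].
destruct (taylor_real f b (1/2) (Hx _ Hh) Hb) as [B1 B2].
rewrite (surjective_pairing (a k)), (surjective_pairing (b k)); f_equal.
- apply (PSeries_ext_recip (fun k => fst (a k)) (fun k => fst (b k)));
    [exact (CV_radius_half _ _ A1)|exact (CV_radius_half _ _ B1)|].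
  refine (filter_imp _ _ _ L). intros x Hr.
  rewrite (is_pseries_unique _ _ _ (proj1 (taylor_real f a x (Hx _ Hr) Ha))).
  now rewrite (is_pseries_unique _ _ _ (proj1 (taylor_real f b x (Hx _ Hr) Hb))).
- apply (PSeries_ext_recip (fun k => snd (a k)) (fun k => snd (b k)));
    [exact (CV_radius_half _ _ A2)|exact (CV_radius_half _ _ B2)|].
  refine (filter_imp _ _ _ L). intros x Hr.
  rewrite (is_pseries_unique _ _ _ (proj2 (taylor_real f a x (Hx _ Hr) Ha))).
  now rewrite (is_pseries_unique _ _ _ (proj2 (taylor_real f b x (Hx _ Hr) Hb))).
Qed.

Lemma hardy_ext (w : weight) (f g : hardy w) : (forall z, f z = g z) -> f = g.
Proof.
destruct f as [f a Ha Sa], g as [g b Hb Sb]; simpl; intros H.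
apply functional_extensionality in H. subst g.
assert (E : a = b) by (apply functional_extensionality; now apply (taylor_unique f)).
subst b. f_equal; apply proof_irrelevance.
Qed.

Section Structure.

Variable w : weight.

Definition term (a : nat -> C) (k : nat) : R := (Cmod (a k))^2 * (beta w k)^2.

Lemma term_pos a k : 0 <= term a k.
Proof. apply Rmult_le_pos; apply pow2_ge_0. Qed.

Lemma term_plus (a b : nat -> C) (p q : R) (k : nat) : 0 < p -> 0 < q ->
  term (fun k => a k + b k)%C k <= (1 + q / p) * term a k + (1 + p / q) * term b k.
Proof.
intros Hp Hq. unfold term.
rewrite <- 2!Rmult_assoc, <- Rmult_plus_distr_r.
apply Rmult_le_compat_r; [apply pow2_ge_0|].
assert (T := Cmod_triangle (a k) (b k)).
assert (X := Cmod_ge_0 (a k)). assert (Y := Cmod_ge_0 (b k)).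
assert (Z := Cmod_ge_0 (a k + b k)).
apply Rle_trans with ((Cmod (a k) + Cmod (b k))^2).
{ apply pow_incr. split; assumption. }
set (x := Cmod (a k)) in *. set (y := Cmod (b k)) in *.
apply Rminus_le_0.
replace (_ - _) with ((q * x - p * y)^2 / (p * q)) by (field; lra).
apply Rle_div_r; [nra|]. rewrite Rmult_0_l. apply pow2_ge_0.
Qed.

Lemma ex_term_plus (a b : nat -> C) : ex_series (term a) -> ex_series (term b) ->
  ex_series (term (fun k => a k + b k)%C).
Proof.
intros Ha Hb.
apply (@ex_series_le R_AbsRing R_CompleteNormedModule _
  (fun k => (1 + 1 / 1) * term a k + (1 + 1 / 1) * term b k)).
{ intros k. change (Rabs (term (fun k => a k + b k)%C k) <=
    (1 + 1 / 1) * term a k + (1 + 1 / 1) * term b k).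
  rewrite Rabs_pos_eq by apply term_pos. apply term_plus; lra. }
apply (ex_series_plus (fun k => (1 + 1 / 1) * term a k)
  (fun k => (1 + 1 / 1) * term b k)).
- exact (ex_series_scal (1 + 1 / 1) (term a) Ha).
- exact (ex_series_scal (1 + 1 / 1) (term b) Hb).
Qed.

Lemma term_scal (c : C) (a : nat -> C) k :
  term (fun k => c * a k)%C k = (Cmod c)^2 * term a k.
Proof. unfold term. rewrite Cmod_mult. ring. Qed.

Lemma ex_term_scal (c : C) (a : nat -> C) : ex_series (term a) ->
  ex_series (term (fun k => c * a k)%C).
Proof.
intros Ha. apply ex_series_ext with (fun k => (Cmod c)^2 * term a k).
{ intros k. now rewrite term_scal. }
exact (ex_series_scal ((Cmod c)^2) (term a) Ha).
Qed.

Lemma taylor_plus (f g : disk -> C) (a b : nat -> C) : taylor f a -> taylor g b ->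
  taylor (fun z => f z + g z)%C (fun k => a k + b k)%C.
Proof.
intros Hf Hg z. exact (is_pseries_plus a b (disk_val z) (f z) (g z) (Hf z) (Hg z)).
Qed.

Lemma taylor_scal (c : C) (f : disk -> C) (a : nat -> C) : taylor f a ->
  taylor (fun z => c * f z)%C (fun k => c * a k)%C.
Proof.
intros Hf z.
refine (@is_pseries_scal C_AbsRing C_NormedModule c a (disk_val z) (f z) _ (Hf z)).
apply Cmult_comm.
Qed.

Definition hardy_plus (f g : hardy w) : hardy w :=
  Hardy (fun z => f z + g z)%C (fun k => hardy_coef f k + hardy_coef g k)%C
    (taylor_plus _ _ _ _ (hardy_taylor f) (hardy_taylor g))
    (ex_term_plus _ _ (hardy_summable f) (hardy_summable g)).

Definition hardy_scal (c : C) (f : hardy w) : hardy w :=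
  Hardy (fun z => c * f z)%C (fun k => c * hardy_coef f k)%C
    (taylor_scal _ _ _ (hardy_taylor f)) (ex_term_scal _ _ (hardy_summable f)).

Definition hardy_opp (f : hardy w) : hardy w := hardy_scal (RtoC (-1)) f.

Lemma taylor_zero : taylor (fun _ => RtoC 0) (fun _ => RtoC 0).
Proof.
intros z. unfold is_pseries, is_series.
apply filterlim_ext with (fun _ => RtoC 0); [|apply filterlim_const].
intros n. symmetry. induction n as [|n IH].
- rewrite sum_O. apply (@scal_zero_r C_AbsRing C_ModuleSpace).
- rewrite sum_Sn, IH. rewrite (@scal_zero_r C_AbsRing C_ModuleSpace).
  apply (@plus_zero_l C_AbelianMonoid).
Qed.

Lemma ex_term_zero : ex_series (term (fun _ => RtoC 0)).
Proof.
apply ex_series_ext with (fun k => 0 * (1/2)^k).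
{ intros k. unfold term. rewrite Cmod_0. simpl. ring. }
apply (ex_series_scal 0 (fun k => (1/2)^k)). apply ex_series_geom.
rewrite Rabs_pos_eq; lra.
Qed.

Definition hardy_zero : hardy w :=
  Hardy (fun _ => RtoC 0) (fun _ => RtoC 0) taylor_zero ex_term_zero.

Lemma hardy_plus_comm f g : hardy_plus f g = hardy_plus g f.
Proof. apply hardy_ext; intros z; simpl. apply Cplus_comm. Qed.

Lemma hardy_plus_assoc f g h :
  hardy_plus f (hardy_plus g h) = hardy_plus (hardy_plus f g) h.
Proof. apply hardy_ext; intros z; simpl. apply Cplus_assoc. Qed.

Lemma hardy_plus_zero f : hardy_plus f hardy_zero = f.
Proof. apply hardy_ext; intros z; simpl. apply Cplus_0_r. Qed.

Lemma hardy_plus_opp f : hardy_plus f (hardy_opp f) = hardy_zero.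
Proof.
apply hardy_ext; intros z. change (f z + RtoC (-1) * f z = RtoC 0)%C. ring.
Qed.

Lemma hardy_scal_assoc (c d : C) f : hardy_scal c (hardy_scal d f) = hardy_scal (c * d)%C f.
Proof. apply hardy_ext; intros z; simpl. ring. Qed.

Lemma hardy_scal_one f : hardy_scal (RtoC 1) f = f.
Proof. apply hardy_ext; intros z; simpl. ring. Qed.

Lemma hardy_scal_plus_r (c : C) f g :
  hardy_scal c (hardy_plus f g) = hardy_plus (hardy_scal c f) (hardy_scal c g).
Proof. apply hardy_ext; intros z; simpl. ring. Qed.

Lemma hardy_scal_plus_l (c d : C) f :
  hardy_scal (c + d)%C f = hardy_plus (hardy_scal c f) (hardy_scal d f).
Proof. apply hardy_ext; intros z; simpl. ring. Qed.

Lemma hardy_norm_pos (f : hardy w) : 0 <= hardy_norm f.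
Proof. apply sqrt_pos. Qed.

Lemma Series_term_pos (a : nat -> C) : ex_series (term a) -> 0 <= Series (term a).
Proof.
intros H. replace 0 with (Series (fun k => 0 * term a k)).
- apply Series_le; [|exact H]. intros k. assert (T := term_pos a k). lra.
- rewrite Series_scal_l. ring.
Qed.

Lemma hardy_norm_plus f g : hardy_norm (hardy_plus f g) <= hardy_norm f + hardy_norm g.
Proof.
assert (Hf := hardy_summable f). assert (Hg := hardy_summable g).
change (ex_series (term (hardy_coef f))) in Hf.
change (ex_series (term (hardy_coef g))) in Hg.
assert (Pf := Series_term_pos _ Hf). assert (Pg := Series_term_pos _ Hg).
apply le_epsilon. intros e He.
set (p := hardy_norm f + e / 2). set (q := hardy_norm g + e / 2).
assert (Hp : 0 < p) by (unfold p; assert (T := hardy_norm_pos f); lra).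
assert (Hq : 0 < q) by (unfold q; assert (T := hardy_norm_pos g); lra).
assert (Sf : Series (term (hardy_coef f)) <= p^2).
{ rewrite <- (sqrt_sqrt _ Pf). change (hardy_norm f * hardy_norm f <= p^2).
  assert (T := hardy_norm_pos f). unfold p. nra. }
assert (Sg : Series (term (hardy_coef g)) <= q^2).
{ rewrite <- (sqrt_sqrt _ Pg). change (hardy_norm g * hardy_norm g <= q^2).
  assert (T := hardy_norm_pos g). unfold q. nra. }
replace (hardy_norm f + hardy_norm g + e) with (p + q) by (unfold p, q; lra).
rewrite <- (sqrt_pow2 (p + q)) by lra.
apply sqrt_le_1_alt.
change (Series (term (fun k => hardy_coef f k + hardy_coef g k)%C) <= (p + q)^2).
apply Rle_trans with (Series (fun k => (1 + q / p) * term (hardy_coef f) k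
                                     + (1 + p / q) * term (hardy_coef g) k)).
{ apply Series_le.
  - intros k. split; [apply term_pos|]. now apply term_plus.
  - apply (ex_series_plus (fun k => (1 + q / p) * term (hardy_coef f) k)
      (fun k => (1 + p / q) * term (hardy_coef g) k)).
    + exact (ex_series_scal (1 + q / p) _ Hf).
    + exact (ex_series_scal (1 + p / q) _ Hg). }
rewrite Series_plus.
2: exact (ex_series_scal (1 + q / p) _ Hf).
2: exact (ex_series_scal (1 + p / q) _ Hg).
rewrite !Series_scal_l.
replace ((p + q)^2) with ((1 + q / p) * p^2 + (1 + p / q) * q^2) by (field; lra).
assert (0 < q / p) by now apply Rdiv_lt_0_compat.
assert (0 < p / q) by now apply Rdiv_lt_0_compat.
apply Rplus_le_compat; apply Rmult_le_compat_l; lra.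
Qed.

Lemma hardy_norm_scal (c : C) f : hardy_norm (hardy_scal c f) = Cmod c * hardy_norm f.
Proof.
unfold hardy_norm at 1.
change (sqrt (Series (term (fun k => c * hardy_coef f k)%C)) = Cmod c * hardy_norm f).
rewrite (Series_ext _ _ (term_scal c (hardy_coef f))), Series_scal_l.
rewrite sqrt_mult_alt by apply pow2_ge_0.
rewrite sqrt_pow2 by apply Cmod_ge_0. reflexivity.
Qed.

Lemma hardy_norm_zero : hardy_norm hardy_zero = 0.
Proof.
replace hardy_zero with (hardy_scal (RtoC 0) hardy_zero).
- rewrite hardy_norm_scal, Cmod_0. ring.
- apply hardy_ext; intros z; simpl. ring.
Qed.

Lemma hardy_norm_eq_zero f : hardy_norm f = 0 -> f = hardy_zero.
Proof.
intros H.
assert (Hf := hardy_summable f). change (ex_series (term (hardy_coef f))) in Hf.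
assert (Z : Series (term (hardy_coef f)) = 0)
  by (apply sqrt_eq_0; [now apply Series_term_pos|exact H]).
assert (A : forall k, hardy_coef f k = RtoC 0).
{ intros k.
  assert (T : term (hardy_coef f) k <= 0).
  { rewrite <- Z.
    rewrite (Series_incr_n (term (hardy_coef f)) (S k)); [|lia|exact Hf].
    simpl pred.
    assert (S1 : term (hardy_coef f) k <= sum_f_R0 (term (hardy_coef f)) k).
    { destruct k as [|k]; [apply Rle_refl|]. simpl.
      assert (P := cond_pos_sum (term (hardy_coef f)) k (term_pos _)). lra. }
    assert (S2 : 0 <= Series (fun j => term (hardy_coef f) (S k + j))).
    { replace 0 with (Series (fun j => 0 * term (hardy_coef f) (S k + j))).
      - apply Series_le.
        + intros j. assert (P := term_pos (hardy_coef f) (S k + j)). lra.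
        + now apply (ex_series_incr_n (term (hardy_coef f)) (S k)).
      - rewrite Series_scal_l. ring. }
    lra. }
  apply Cmod_eq_0. unfold term in T.
  assert (B : 0 < (beta w k)^2) by (apply pow_lt, beta_pos).
  assert (P := Cmod_ge_0 (hardy_coef f k)).
  destruct P as [P|P]; [|now symmetry].
  exfalso. assert (Q : 0 < Cmod (hardy_coef f k) ^ 2) by now apply pow_lt.
  assert (0 < (Cmod (hardy_coef f k))^2 * (beta w k)^2) by now apply Rmult_lt_0_compat.
  lra. }
apply hardy_ext. intros z.
assert (U := hardy_taylor f z).
assert (V := taylor_zero z).
simpl. apply (@filterlim_locally_unique _ C_AbsRing C_NormedModule eventually _
  (sum_n (fun k => scal (@pow_n C_AbsRing (disk_val z) k) (hardy_coef f k)))); [exact U|].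
apply (is_series_ext (V := C_NormedModule)) with (2 := V).
intros k. now rewrite A.
Qed.

End Structure.

Section Canonical_structures.

Variable w : weight.

Definition hardy_AbelianMonoid_mixin := AbelianMonoid.Mixin (hardy w)
  (hardy_plus w) (hardy_zero w) (hardy_plus_comm w) (hardy_plus_assoc w) (hardy_plus_zero w).

Canonical hardy_AbelianMonoid :=
  AbelianMonoid.Pack (hardy w) hardy_AbelianMonoid_mixin (hardy w).

Definition hardy_AbelianGroup_mixin :=
  AbelianGroup.Mixin hardy_AbelianMonoid (hardy_opp w) (hardy_plus_opp w).

Canonical hardy_AbelianGroup := AbelianGroup.Pack (hardy w)
  (AbelianGroup.Class _ _ hardy_AbelianGroup_mixin) (hardy w).

Definition hardy_ModuleSpace_mixin := ModuleSpace.Mixin C_Ring hardy_AbelianGroup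
  (hardy_scal w) (hardy_scal_assoc w) (hardy_scal_one w)
  (hardy_scal_plus_r w) (hardy_scal_plus_l w).

Canonical hardy_ModuleSpace := ModuleSpace.Pack C_Ring (hardy w)
  (ModuleSpace.Class C_Ring _ _ hardy_ModuleSpace_mixin) (hardy w).

Definition hardy_ball (f : hardy w) (e : R) (g : hardy w) : Prop :=
  hardy_norm (minus g f) < e.

Lemma hardy_ball_refl (f : hardy w) (e : posreal) : hardy_ball f e f.
Proof.
unfold hardy_ball. rewrite minus_eq_zero.
change (hardy_norm (hardy_zero w) < e). rewrite hardy_norm_zero. apply cond_pos.
Qed.

Lemma hardy_ball_sym (f g : hardy w) (e : R) : hardy_ball f e g -> hardy_ball g e f.
Proof.
unfold hardy_ball. intros H.
replace (minus f g) with (hardy_scal w (RtoC (-1)) (minus g f)).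
- rewrite hardy_norm_scal, Cmod_R, Rabs_left by lra. lra.
- apply hardy_ext; intros z; simpl. ring.
Qed.

Lemma hardy_ball_triangle (f g h : hardy w) (d e : R) :
  hardy_ball f d g -> hardy_ball g e h -> hardy_ball f (d + e) h.
Proof.
unfold hardy_ball. intros H K.
replace (minus h f) with (hardy_plus w (minus g f) (minus h g)).
- eapply Rle_lt_trans; [apply hardy_norm_plus|]. lra.
- apply hardy_ext; intros z; simpl. ring.
Qed.

Definition hardy_UniformSpace_mixin := UniformSpace.Mixin (hardy w) (hardy_zero w)
  hardy_ball hardy_ball_refl hardy_ball_sym hardy_ball_triangle.

Canonical hardy_UniformSpace :=
  UniformSpace.Pack (hardy w) hardy_UniformSpace_mixin (hardy w).

Canonical hardy_NormedModuleAux := NormedModuleAux.Pack C_AbsRing (hardy w)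
  (NormedModuleAux.Class C_AbsRing _ (ModuleSpace.class C_Ring hardy_ModuleSpace)
    (UniformSpace.class hardy_UniformSpace)) (hardy w).

Lemma hardy_norm_ball1 (f g : hardy w) (e : R) :
  hardy_norm (minus g f) < e -> ball f e g.
Proof. intros H. exact H. Qed.

Lemma hardy_norm_ball2 (f g : hardy w) (e : posreal) :
  ball f e g -> hardy_norm (minus g f) < 1 * e.
Proof. intros H. rewrite Rmult_1_l. exact H. Qed.

Lemma hardy_norm_scal_le (c : C) (f : hardy w) :
  hardy_norm (hardy_scal w c f) <= Cmod c * hardy_norm f.
Proof. rewrite hardy_norm_scal. apply Rle_refl. Qed.

Definition hardy_NormedModule_mixin := NormedModule.Mixin C_AbsRing hardy_NormedModuleAux
  hardy_norm 1 (hardy_norm_plus w) hardy_norm_scal_le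
  hardy_norm_ball1 hardy_norm_ball2 (hardy_norm_eq_zero w).

Canonical hardy_NormedModule := NormedModule.Pack C_AbsRing (hardy w)
  (NormedModule.Class C_AbsRing _ _ hardy_NormedModule_mixin) (hardy w).

End Canonical_structures.

(* In Coquelicot, [is_linear] means linear and bounded. *)
Definition bounded_inverse {V : NormedModule C_AbsRing} (A B : V -> V) : Prop :=
  is_linear B /\ (forall x, B (A x) = x) /\ (forall x, A (B x) = x).

Definition spectrum {V : NormedModule C_AbsRing} (T : V -> V) (lambda : C) : Prop :=
  ~ exists B : V -> V, bounded_inverse (fun x => minus (T x) (scal lambda x)) B.

Definition expi (theta : R) : C := (cos theta, sin theta).

Definition moebius (theta : R) (z0 z : C) : C :=
  (expi theta * ((z0 - z) / (1 - Cconj z0 * z)))%C.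

Definition disk_automorphism (phi : disk -> disk) (theta : R) (z0 : disk) : Prop :=
  forall z : disk, phi z = moebius theta z0 z :> C.

Definition zero_of_order (g : C -> C) (zeta : C) (n : nat) : Prop :=
  exists h : C -> C,
    continuous h zeta /\ h zeta <> RtoC 0 /\
    locally zeta (fun z => g z = ((z - zeta) ^ n * h z)%C).

(* Fixed points are those of the Moebius map on the Riemann sphere. The point at
   infinity is fixed only when [z0 = 0]; then 0 is fixed as well, so that it is
   enough to require uniqueness among the finite points, where [moebius] is
   defined off its pole. *)
Definition parabolic_disk_automorphism (phi : disk -> disk) : Prop :=
  exists (theta : R) (z0 : disk),
    disk_automorphism phi theta z0 /\
    exists zeta : C,
      Cmod zeta = 1 /\
      zero_of_order (fun z => moebius theta z0 z - z)%C zeta 2 /\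
      forall eta : C, (1 - Cconj z0 * eta)%C <> RtoC 0 ->
        moebius theta z0 eta = eta -> eta = zeta.

Definition composition_operator {w : weight} (phi : disk -> disk)
  (T : hardy w -> hardy w) : Prop :=
  forall (f : hardy w) (z : disk), T f z = f (phi z).

(* Main.v *)
Require Import Defs.
From Stdlib Require Import Reals Lra Lia Classical IndefiniteDescription FunctionalExtensionality.
From Coquelicot Require Import Coquelicot.

(* Boundedness. For real [s] put [h_s(z) = (s + z) / (1 + s z)]. The Taylor
   coefficients [c_k(s)] of [f o h_s] satisfy
   [(1 - s^2) c_k' = (k+1) c_{k+1} - (k-1) c_{k-1}], so in the derivative of
   [sum beta_k^2 c_k^2] the product [c_k c_{k+1}] has the coefficient
   [2 ((k+1) beta_k^2 - k beta_{k+1}^2)], and polynomial growth of the weight says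
   exactly that this is [O(beta_k beta_{k+1})]. By Gronwall, composition with
   [h_s] has norm at most [((1+s)/(1-s))^K].
   In the coordinate [1 / (1 - Cconj zeta z)] a parabolic automorphism fixing
   [zeta] is the translation by [i b] with [b] real and nonzero; the translation
   by [i c] is [h_s], [s = |c| / sqrt (1 + c^2)], between two rotations. Hence the
   powers of [C_phi] and of its inverse have polynomially growing norms, and
   Neumann series invert [C_phi - mu] for every [mu] off the unit circle.
   Conversely, let [C_phi - lambda] be invertible with [|lambda| = 1]. The
   resolvents at [lambda / r] and [r lambda], applied to a function [f] and
   evaluated at 0, then have the same limit as [r] tends to 1 from below, that is,
   the two-sided Abel sum of [lambda^-n f(phi^n(0))] vanishes. For
   [f(z) = (1 - Cconj zeta z)^(2p)] one has [f(phi^n(0)) = (1 + i b n)^(-2p)], and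
   for [p] large the term [n = 0] outweighs all the others: a contradiction. *)

Open Scope R_scope.

(** * Series *)

Lemma sum_n_S (u : nat -> R) (n : nat) : sum_n u (S n) = sum_n u n + u (S n).
Proof. now rewrite sum_Sn. Qed.

Lemma sum_n_mono (u : nat -> R) (n N : nat) : (forall k, 0 <= u k) ->
  (n <= N)%nat -> sum_n u n <= sum_n u N.
Proof.
intros Hu H. induction H as [|N H IH]; [lra|]. rewrite sum_n_S. specialize (Hu (S N)). lra.
Qed.

Lemma sum_n_finite_support (u : nat -> R) (n N : nat) : (forall k, 0 <= u k) ->
  (forall k, (n < k)%nat -> u k = 0) -> sum_n u N <= sum_n u n.
Proof.
intros Hu Hn. destruct (Compare_dec.le_dec N n) as [H|H]; [now apply sum_n_mono|].
replace N with (n + (N - n))%nat by lia. generalize (N - n)%nat as m.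
induction m as [|m IH]; [rewrite Nat.add_0_r; lra|].
rewrite Nat.add_succ_r, sum_n_S, Hn by lia. lra.
Qed.

Lemma nonneg_term_le_sum (u : nat -> R) (k : nat) :
  (forall k, 0 <= u k) -> u k <= sum_n u k.
Proof.
intros Hu. destruct k as [|k]; [rewrite sum_O; lra|]. rewrite sum_n_S.
assert (P := sum_n_mono u 0 k Hu (Nat.le_0_l k)). rewrite sum_O in P.
specialize (Hu O). lra.
Qed.

Lemma nonneg_series_bounded (u : nat -> R) (S : R) :
  (forall k, 0 <= u k) -> (forall N, sum_n u N <= S) -> ex_series u /\ Series u <= S.
Proof.
intros Hu HS.
destruct (ex_finite_lim_seq_incr (sum_n u) S) as [l Hl]; [|exact HS|].
{ intros n. rewrite sum_Sn. unfold plus; simpl. specialize (Hu (Datatypes.S n)). lra. }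
assert (Hs : is_series u l) by exact Hl.
split; [now exists l|].
rewrite (is_series_unique _ _ Hs).
change (Rbar_le l S).
apply (is_lim_seq_le (sum_n u) (fun _ => S)); [exact HS|exact Hl|apply is_lim_seq_const].
Qed.

Lemma nonneg_partial_le (u : nat -> R) (N : nat) :
  (forall k, 0 <= u k) -> ex_series u -> sum_n u N <= Series u.
Proof.
intros Hu Hs. apply Series_correct in Hs.
change (Rbar_le (sum_n u N) (Series u)).
apply (is_lim_seq_le_loc (fun _ => sum_n u N) (sum_n u));
  [|apply is_lim_seq_const|exact Hs].
exists N. intros n Hn. induction Hn as [|n Hn IH]; [lra|].
rewrite sum_Sn. unfold plus; simpl. specialize (Hu (S n)). lra.
Qed.

Lemma pow_n_Cpow (z : C) (k : nat) : @pow_n C_AbsRing z k = (z ^ k)%C.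
Proof. induction k as [|k IH]; [reflexivity|]. simpl. now rewrite IH. Qed.

Notation Csum := (@sum_n C_AbelianMonoid).
Notation is_Cseries := (@is_series C_AbsRing C_NormedModule).

Lemma Csum_S (u : nat -> C) (n : nat) : Csum u (S n) = (Csum u n + u (S n))%C :> C.
Proof. now rewrite sum_Sn. Qed.

Lemma Csum_ext (u v : nat -> C) (n : nat) : (forall k, u k = v k) -> Csum u n = Csum v n.
Proof. intros H. now apply sum_n_ext. Qed.

Lemma Csum_shift (u : nat -> C) (n : nat) :
  Csum u (S n) = (u O + Csum (fun k => u (S k)) n)%C :> C.
Proof.
induction n as [|n IH]; [now rewrite Csum_S, !sum_O|].
rewrite Csum_S, IH, Csum_S. ring.
Qed.

Lemma Csum_scal (c : C) (u : nat -> C) (n : nat) :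
  Csum (fun k => c * u k)%C n = (c * Csum u n)%C :> C.
Proof.
induction n as [|n IH]; [now rewrite !sum_O|]. rewrite !Csum_S, IH. ring.
Qed.

Lemma Cmod_Csum (u : nat -> C) (n : nat) : Cmod (Csum u n) <= sum_n (fun k => Cmod (u k)) n.
Proof.
induction n as [|n IH]; [rewrite !sum_O; lra|].
rewrite Csum_S, sum_Sn. eapply Rle_trans; [apply Cmod_triangle|].
unfold plus; simpl. lra.
Qed.

Lemma is_Cseries_spec (u : nat -> C) (l : C) :
  is_Cseries u l <->
  forall eps, 0 < eps -> exists N, forall n, (N <= n)%nat -> Cmod (Csum u n - l) < eps.
Proof.
split.
- intros H eps He.
  assert (L : locally l (fun y : C => Cmod (y - l) < eps)).
  { apply (locally_le_locally_norm (V := C_NormedModule)).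
    exists (mkposreal eps He). intros y Hy. exact Hy. }
  destruct (H _ L) as [N HN]. exists N. exact HN.
- intros H P HP.
  apply (locally_norm_le_locally (V := C_NormedModule)) in HP.
  destruct HP as [e He]. destruct (H e (cond_pos e)) as [N HN].
  exists N. intros n Hn. apply He. exact (HN n Hn).
Qed.

Lemma is_Cseries_unique (u : nat -> C) (l m : C) :
  is_Cseries u l -> is_Cseries u m -> l = m.
Proof. exact (@filterlim_locally_unique _ C_AbsRing C_NormedModule eventually _ _ l m). Qed.

Lemma Cseries_dominated (u : nat -> C) (v : nat -> R) :
  (forall k, Cmod (u k) <= v k) -> ex_series v ->
  exists l, is_Cseries u l /\ Cmod l <= Series v.
Proof.
intros H Hv.
destruct (@ex_series_le C_AbsRing C_CompleteNormedModule u v H Hv) as [l Hl].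
exists l. split; [exact Hl|].
apply le_epsilon. intros e He.
destruct (proj1 (is_Cseries_spec u l) Hl e He) as [N HN].
specialize (HN N (le_n N)).
assert (B : Cmod (Csum u N) <= Series v).
{ eapply Rle_trans; [apply Cmod_Csum|].
  apply Rle_trans with (sum_n v N); [now apply sum_n_m_le|].
  apply nonneg_partial_le; [|exact Hv].
  intros k. eapply Rle_trans; [apply Cmod_ge_0|apply H]. }
replace l with (Csum u N + - (Csum u N - l))%C by ring.
eapply Rle_trans; [apply Cmod_triangle|]. rewrite Cmod_opp. lra.
Qed.

(** Convergence in the plane is phrased as a real limit, so that squeezing and the arithmetic of
    [is_lim_seq] apply. *)
Definition Clim (x : nat -> C) (a : C) : Prop := is_lim_seq (fun n => Cmod (x n - a)) 0.

Lemma is_lim_seq_squeeze_0 (u v : nat -> R) :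
  (forall n, 0 <= u n <= v n) -> is_lim_seq v 0 -> is_lim_seq u 0.
Proof.
intros H Hv. apply (is_lim_seq_le_le (fun _ => 0) u v); [exact H| |exact Hv].
apply is_lim_seq_const.
Qed.

Lemma Clim_Cmod (x : nat -> C) (a : C) : Clim x a -> is_lim_seq (fun n => Cmod (x n)) (Cmod a).
Proof.
intros H.
apply (is_lim_seq_le_le (fun n => Cmod a - Cmod (x n - a)) _
  (fun n => Cmod a + Cmod (x n - a))).
- intros n. split.
  + assert (T := Cmod_triangle (x n) (- (x n - a))).
    replace (x n + - (x n - a))%C with a in T by ring. rewrite Cmod_opp in T. lra.
  + assert (T := Cmod_triangle a (x n - a)).
    replace (a + (x n - a))%C with (x n) in T by ring. exact T.
- replace (Finite (Cmod a)) with (Finite (Cmod a - 0)) by (f_equal; ring).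
  apply is_lim_seq_minus'; [apply is_lim_seq_const|exact H].
- replace (Finite (Cmod a)) with (Finite (Cmod a + 0)) by (f_equal; ring).
  apply is_lim_seq_plus'; [apply is_lim_seq_const|exact H].
Qed.

Lemma Clim_unique (x : nat -> C) (a b : C) : Clim x a -> Clim x b -> a = b.
Proof.
intros Ha Hb.
assert (H : is_lim_seq (fun _ => Cmod (a - b)) 0).
{ apply is_lim_seq_squeeze_0 with (fun n => Cmod (x n - a) + Cmod (x n - b)).
  - intros n. split; [apply Cmod_ge_0|].
    assert (T := Cmod_triangle (- (x n - a)) (x n - b)).
    replace (- (x n - a) + (x n - b))%C with (a - b)%C in T by ring.
    now rewrite Cmod_opp in T.
  - replace (Finite 0) with (Finite (0 + 0)) by (f_equal; ring).
    now apply is_lim_seq_plus'. }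
apply is_lim_seq_unique in H. rewrite Lim_seq_const in H. injection H as H.
apply Cmod_eq_0 in H. replace a with (a - b + b)%C by ring. rewrite H. ring.
Qed.

Lemma is_Cseries_Clim (u : nat -> C) (l : C) : is_Cseries u l <-> Clim (Csum u) l.
Proof.
rewrite is_Cseries_spec. unfold Clim. rewrite <- is_lim_seq_spec. split.
- intros H e. destruct (H e (cond_pos e)) as [N HN]. exists N. intros n Hn.
  rewrite Rminus_0_r, Rabs_pos_eq by apply Cmod_ge_0. now apply HN.
- intros H e He. destruct (H (mkposreal e He)) as [N HN]. exists N. intros n Hn.
  specialize (HN n Hn). rewrite Rminus_0_r, Rabs_pos_eq in HN by apply Cmod_ge_0. exact HN.
Qed.

Lemma Clim_cauchy (x : nat -> C) :
  (forall eps, 0 < eps -> exists N, forall m n, (N <= m)%nat -> (N <= n)%nat ->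
    Cmod (x m - x n) < eps) -> exists a, Clim x a.
Proof.
intros H.
(* Real and imaginary parts are 1-Lipschitz for [Cmod], so both inherit the Cauchy property. *)
assert (P : forall p : C -> R, (forall y z, Rabs (p y - p z) <= Cmod (y - z)) ->
  ex_finite_lim_seq (fun n => p (x n))).
{ intros p Hp. apply ex_lim_seq_cauchy_corr. intros e.
  destruct (H e (cond_pos e)) as [N HN]. exists N. intros m n Hm Hn.
  eapply Rle_lt_trans; [apply Hp|]. now apply HN. }
destruct (P fst) as [a Ha].
{ intros y z. apply Rle_trans with (2 := re_le_Cmod (y - z)%C). right; reflexivity. }
destruct (P snd) as [b Hb].
{ intros y z. apply Rle_trans with (2 := Rmax_Cmod (y - z)%C). apply Rmax_r. }
exists (a, b).
apply is_lim_seq_squeeze_0 with (fun n => Rabs (fst (x n) - a) + Rabs (snd (x n) - b)).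
- intros n. split; [apply Cmod_ge_0|].
  set (p := fst (x n) - a). set (q := snd (x n) - b).
  replace (x n - (a, b))%C with (RtoC p + Ci * RtoC q)%C.
  + eapply Rle_trans; [apply Cmod_triangle|].
    rewrite Cmod_mult, !Cmod_R. rewrite Cmod_Ci. lra.
  + unfold p, q. destruct (x n). apply injective_projections; simpl; ring.
- assert (L : forall (y : nat -> R) (l : R), is_lim_seq y l ->
    is_lim_seq (fun n => Rabs (y n - l)) 0).
  { intros y l Hy. apply -> (is_lim_seq_abs_0 (fun n => y n - l)).
    replace (Finite 0) with (Finite (l - l)) by (f_equal; ring).
    apply is_lim_seq_minus'; [exact Hy|apply is_lim_seq_const]. }
  replace (Finite 0) with (Finite (0 + 0)) by (f_equal; ring).
  apply is_lim_seq_plus'; now apply L.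
Qed.

Lemma Clim_plus (x y : nat -> C) (a b : C) :
  Clim x a -> Clim y b -> Clim (fun n => x n + y n)%C (a + b)%C.
Proof.
intros Ha Hb.
apply is_lim_seq_squeeze_0 with (fun n => Cmod (x n - a) + Cmod (y n - b)).
- intros n. split; [apply Cmod_ge_0|].
  replace (x n + y n - (a + b))%C with ((x n - a) + (y n - b))%C by ring.
  apply Cmod_triangle.
- replace (Finite 0) with (Finite (0 + 0)) by (f_equal; ring).
  now apply is_lim_seq_plus'.
Qed.

Lemma Clim_scal (c : C) (x : nat -> C) (a : C) :
  Clim x a -> Clim (fun n => c * x n)%C (c * a)%C.
Proof.
intros Ha. unfold Clim.
apply is_lim_seq_ext with (fun n => Cmod c * Cmod (x n - a)).
- intros n. rewrite <- Cmod_mult. f_equal. ring.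
- replace (Finite 0) with (Rbar_mult (Cmod c) 0) by (simpl; f_equal; ring).
  now apply is_lim_seq_scal_l.
Qed.

Lemma Clim_S (x : nat -> C) (a : C) : Clim x a -> Clim (fun n => x (S n)) a.
Proof. intros H. exact (proj1 (is_lim_seq_incr_1 (fun n => Cmod (x n - a)) 0) H). Qed.

Lemma Clim_ext (x y : nat -> C) (a : C) : (forall n, x n = y n) -> Clim x a -> Clim y a.
Proof. intros H. apply is_lim_seq_ext. intros n. now rewrite H. Qed.

Lemma Clim_const (a : C) : Clim (fun _ => a) a.
Proof.
unfold Clim. replace (Cmod (a - a)) with 0; [apply is_lim_seq_const|].
replace (a - a)%C with (RtoC 0) by ring. now rewrite Cmod_0.
Qed.

Lemma Csub_0_r (x : C) : (x - 0)%C = x.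
Proof. ring. Qed.

Lemma Clim_bound (x : nat -> C) (a c : C) (e : R) :
  Clim x a -> (forall n, Cmod (x n - c) <= e) -> Cmod (a - c) <= e.
Proof.
intros Hx He.
assert (L : Clim (fun n => x n + - c)%C (a + - c)%C) by (apply Clim_plus; [exact Hx|apply Clim_const]).
apply Clim_Cmod in L. change (Rbar_le (Cmod (a - c)) e).
apply (is_lim_seq_le (fun n => Cmod (x n + - c)) (fun _ => e)); [exact He|exact L|].
apply is_lim_seq_const.
Qed.

Lemma taylor_Cseries (f : disk -> C) (a : nat -> C) :
  taylor f a <-> forall z : disk, is_Cseries (fun k => a k * disk_val z ^ k)%C (f z).
Proof.
split; intros H z; apply (is_series_ext (V := C_NormedModule)) with (2 := H z);
  intros k; [|symmetry];
  exact (eq_trans (f_equal (fun x : C => (x * a k)%C) (pow_n_Cpow (disk_val z) k))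
    (Cmult_comm _ _)).
Qed.

(** * Weighted Hardy spaces *)

Section Weighted.
Variable w : weight.

Lemma sum_term_le_norm (f : hardy w) (N : nat) :
  sum_n (term w (hardy_coef f)) N <= hardy_norm f ^ 2.
Proof.
unfold hardy_norm.
rewrite pow2_sqrt by (apply (Series_term_pos w), hardy_summable).
apply (nonneg_partial_le (term w (hardy_coef f))); [apply term_pos|apply hardy_summable].
Qed.

Lemma norm_le_of_sums (f : hardy w) (A : R) : 0 <= A ->
  (forall N, sum_n (term w (hardy_coef f)) N <= A ^ 2) -> hardy_norm f <= A.
Proof.
intros HA H. unfold hardy_norm.
rewrite <- (sqrt_pow2 A) by exact HA. apply sqrt_le_1_alt.
apply (nonneg_series_bounded _ _ (term_pos w (hardy_coef f)) H).
Qed.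

Lemma coef_le_norm (f : hardy w) (k : nat) :
  Cmod (hardy_coef f k) * beta w k <= hardy_norm f.
Proof.
apply Rsqr_incr_0_var; [|apply hardy_norm_pos].
apply Rle_trans with (2 := Rle_trans _ _ _
  (sum_term_le_norm f k) (Req_le _ _ (eq_sym (Rsqr_pow2 _)))).
apply Rle_trans with (term w (hardy_coef f) k).
- unfold term, Rsqr. right. ring.
- apply nonneg_term_le_sum, term_pos.
Qed.

Lemma weight_ratio_lim : is_lim_seq (fun n => w (S n)) 1.
Proof. apply (is_lim_seq_incr_1 w), weight_lim. Qed.

(** Ratio test: since [w k] tends to 1, the ratio of consecutive terms tends to [r^2 < 1]. The
    series controls evaluation at points of modulus below [r]. *)
Lemma ex_series_pow_div_beta (r : R) : 0 < r < 1 ->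
  ex_series (fun k => (r ^ k / beta w k) ^ 2).
Proof.
intros Hr.
assert (P : forall k, 0 < r ^ k / beta w k).
{ intros k. apply Rdiv_lt_0_compat; [apply pow_lt; lra|apply beta_pos]. }
apply ex_series_ext with (fun k => Rabs ((r ^ k / beta w k) ^ 2)).
{ intros k. apply Rabs_pos_eq, pow2_ge_0. }
apply ex_series_DAlembert with (r * r).
- nra.
- intros k. apply pow_nonzero, Rgt_not_eq, P.
- apply is_lim_seq_ext with (fun n => (r * / w (S n)) * (r * / w (S n))).
  { intros n. simpl beta. simpl (r ^ S n).
    assert (B := beta_pos w n). assert (W := weight_pos w (S n) ltac:(lia)).
    assert (R1 := pow_lt r n (proj1 Hr)).
    replace ((r * r ^ n / (beta w n * w (S n))) ^ 2 / (r ^ n / beta w n) ^ 2)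
      with ((r * / w (S n)) ^ 2) by (field; repeat split; lra).
    rewrite Rabs_pos_eq by apply pow2_ge_0. ring. }
  assert (L : is_lim_seq (fun n => r * / w (S n)) r).
  { replace (Finite r) with (Rbar_mult r (Rbar_inv 1)).
    - apply is_lim_seq_scal_l, is_lim_seq_inv; [apply weight_ratio_lim|].
      intros H; injection H; lra.
    - simpl. f_equal. field. }
  change (Finite (r * r)) with (Rbar_mult r r).
  now apply is_lim_seq_mult'.
Qed.

(* Cauchy-Schwarz, through [2 x y <= t x^2 + y^2 / t] so that only series of
   squares occur. *)
Lemma Cseries_at_point (z : disk) : exists K, 0 <= K /\
  forall a : nat -> C, ex_series (term w a) ->
    exists l, is_Cseries (fun k => a k * disk_val z ^ k)%C l /\
      forall t, 0 < t -> Cmod l <= (t * Series (term w a) + K / t) / 2.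
Proof.
destruct z as [z Hz]. simpl.
(* A radius strictly between [|z|] and 1, and positive even when [z = 0]. *)
set (r := (1 + Cmod z) / 2). assert (M0 := Cmod_ge_0 z).
assert (Hr : 0 < r < 1) by (unfold r; lra).
assert (E := ex_series_pow_div_beta r Hr).
exists (Series (fun k => (r ^ k / beta w k) ^ 2)). split.
{ apply Rle_trans with (2 := nonneg_partial_le _ 0 (fun k => pow2_ge_0 _) E).
  rewrite sum_O. apply pow2_ge_0. }
intros a Ha.
set (v := fun t k => t / 2 * term w a k + / (2 * t) * (r ^ k / beta w k) ^ 2).
assert (D : forall t, 0 < t -> forall k, Cmod (a k * z ^ k)%C <= v t k).
{ intros t Ht k. unfold v, term.
  assert (B := beta_pos w k).
  assert (Z : Cmod (z ^ k)%C <= r ^ k).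
  { rewrite Cmod_pow. apply pow_incr. unfold r; lra. }
  rewrite Cmod_mult.
  assert (A0 := Cmod_ge_0 (a k)).
  apply Rle_trans with ((Cmod (a k) * beta w k) * (r ^ k / beta w k)).
  { replace (Cmod (a k) * beta w k * (r ^ k / beta w k)) with (Cmod (a k) * r ^ k)
      by (field; lra). now apply Rmult_le_compat_l. }
  set (x := Cmod (a k) * beta w k). set (y := r ^ k / beta w k).
  replace (Cmod (a k) ^ 2 * beta w k ^ 2) with (x ^ 2) by (unfold x; ring).
  apply Rminus_le_0.
  replace (_ - _) with ((t * x - y) ^ 2 / (2 * t)) by (field; lra).
  apply Rle_div_r; [lra|]. rewrite Rmult_0_l. apply pow2_ge_0. }
assert (V : forall t, is_series (v t)
  (t / 2 * Series (term w a) + / (2 * t) * Series (fun k => (r ^ k / beta w k) ^ 2))).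
{ intros t.
  apply (is_series_plus (fun k => t / 2 * term w a k)
    (fun k => / (2 * t) * (r ^ k / beta w k) ^ 2)).
  - apply (is_series_scal (t / 2) (term w a)), Series_correct, Ha.
  - apply (is_series_scal (/ (2 * t)) (fun k => (r ^ k / beta w k) ^ 2)),
      Series_correct, E. }
(* The sum is obtained with [t = 1]; by uniqueness the bounds for all other [t] concern the same
   [l]. *)
destruct (Cseries_dominated _ _ (D 1 Rlt_0_1) (ex_intro _ _ (V 1))) as [l [Hl _]].
exists l. split; [exact Hl|]. intros t Ht.
destruct (Cseries_dominated _ _ (D t Ht) (ex_intro _ _ (V t))) as [m [Hm Bm]].
rewrite (is_Cseries_unique _ _ _ Hl Hm).
rewrite (is_series_unique _ _ (V t)) in Bm.
eapply Rle_trans; [exact Bm|]. right. field. lra.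
Qed.

Lemma hardy_of_coef (a : nat -> C) :
  ex_series (term w a) -> exists f : hardy w, hardy_coef f = a.
Proof.
intros Ha.
destruct (functional_choice (fun (z : disk) l =>
  is_Cseries (fun k => a k * disk_val z ^ k)%C l)) as [f Hf].
{ intros z. destruct (Cseries_at_point z) as [K [_ H]].
  destruct (H a Ha) as [l [Hl _]]. now exists l. }
exists (Hardy f a (proj2 (taylor_Cseries f a) Hf) Ha). reflexivity.
Qed.

Lemma hardy_eval_bound (z : disk) :
  exists K, 0 <= K /\ forall f : hardy w, Cmod (f z) <= K * hardy_norm f.
Proof.
destruct (Cseries_at_point z) as [K [HK H]].
exists ((1 + K) / 2). split; [lra|]. intros f.
destruct (H (hardy_coef f) (hardy_summable f)) as [l [Hl Bl]].
rewrite (is_Cseries_unique _ _ _ (proj1 (taylor_Cseries _ _) (hardy_taylor f) z) Hl).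
destruct (hardy_norm_pos w f) as [P|P].
(* With [t] the inverse of the norm, both terms of the bound become multiples of the norm. *)
- specialize (Bl (/ hardy_norm f) (Rinv_0_lt_compat _ P)).
  assert (E : Series (term w (hardy_coef f)) = hardy_norm f ^ 2).
  { unfold hardy_norm. rewrite pow2_sqrt; [reflexivity|].
    apply (Series_term_pos w), hardy_summable. }
  rewrite E in Bl. eapply Rle_trans; [exact Bl|]. right. field. lra.
- symmetry in P. assert (Z := hardy_norm_eq_zero w f P).
  assert (E : l = RtoC 0).
  { apply (is_Cseries_unique _ _ _ Hl).
    subst f. exact (proj1 (taylor_Cseries _ _) (hardy_taylor (hardy_zero w)) z). }
  rewrite E, Cmod_0, P. lra.
Qed.

Lemma Cmod_at_zero (f : hardy w) (o : disk) :
  disk_val o = RtoC 0 -> Cmod (f o) <= hardy_norm f.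
Proof.
intros Ho.
assert (T := proj1 (taylor_Cseries _ _) (hardy_taylor f) o).
assert (E : f o = hardy_coef f 0).
{ apply (is_Cseries_unique _ _ _ T). apply is_Cseries_spec. intros e He.
  exists O. intros n _. rewrite Ho.
  replace (Csum (fun k => hardy_coef f k * RtoC 0 ^ k)%C n) with (hardy_coef f 0).
  - replace (hardy_coef f 0 - hardy_coef f 0)%C with (RtoC 0) by ring. now rewrite Cmod_0.
  - induction n as [|n IH]; [rewrite sum_O; simpl; ring|].
    rewrite Csum_S, <- IH. simpl. ring. }
rewrite E. apply Rle_trans with (2 := coef_le_norm f 0). simpl. lra.
Qed.

End Weighted.

(** * Completeness, and bounded composition from its action on polynomials *)

Section Completeness.
Variable w : weight.

Definition hsub (f g : hardy w) : hardy w := hardy_plus w f (hardy_opp w g).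

Lemma hsub_eval (f g : hardy w) (z : disk) : hsub f g z = (f z - g z)%C.
Proof. change (f z + RtoC (-1) * g z = f z - g z)%C. ring. Qed.

Lemma hsub_coef (f g : hardy w) (k : nat) :
  hardy_coef (hsub f g) k = (hardy_coef f k - hardy_coef g k)%C.
Proof.
change (hardy_coef f k + RtoC (-1) * hardy_coef g k = hardy_coef f k - hardy_coef g k)%C.
ring.
Qed.

Lemma hsub_swap (f g : hardy w) : hardy_norm (hsub f g) = hardy_norm (hsub g f).
Proof.
replace (hsub f g) with (hardy_scal w (RtoC (-1)) (hsub g f)).
- rewrite hardy_norm_scal, Cmod_R, Rabs_left by lra. ring.
- apply hardy_ext; intros z. rewrite hsub_eval.
  change (RtoC (-1) * hsub g f z = f z - g z)%C. rewrite hsub_eval. ring.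
Qed.

Lemma hsub_triangle (f g h : hardy w) :
  hardy_norm (hsub f h) <= hardy_norm (hsub f g) + hardy_norm (hsub g h).
Proof.
replace (hsub f h) with (hardy_plus w (hsub f g) (hsub g h)); [apply hardy_norm_plus|].
apply hardy_ext; intros z. rewrite hsub_eval.
change (hsub f g z + hsub g h z = f z - h z)%C. rewrite !hsub_eval. ring.
Qed.

Lemma norm_le_hsub (f g : hardy w) : hardy_norm f <= hardy_norm (hsub f g) + hardy_norm g.
Proof.
replace f with (hardy_plus w (hsub f g) g) at 1; [apply hardy_norm_plus|].
apply hardy_ext; intros z. change (hsub f g z + g z = f z)%C. rewrite hsub_eval. ring.
Qed.

Definition hlim (u : nat -> hardy w) (l : hardy w) : Prop :=
  is_lim_seq (fun n => hardy_norm (hsub (u n) l)) 0.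

Lemma lim_sum_term (x : nat -> nat -> C) (a : nat -> C) (J : nat) :
  (forall k, Clim (fun m => x m k) (a k)) ->
  is_lim_seq (fun m => sum_n (term w (x m)) J) (sum_n (term w a) J).
Proof.
intros H.
assert (T : forall k, is_lim_seq (fun m => term w (x m) k) (term w a k)).
{ intros k. unfold term. apply is_lim_seq_mult'; [|apply is_lim_seq_const].
  assert (L := Clim_Cmod _ _ (H k)). simpl.
  apply is_lim_seq_mult'; [exact L|]. apply is_lim_seq_mult'; [exact L|].
  apply is_lim_seq_const. }
induction J as [|J IH].
- rewrite sum_O. apply is_lim_seq_ext with (2 := T O). intros m. now rewrite sum_O.
- rewrite sum_Sn.
  apply is_lim_seq_ext with (fun m => sum_n (term w (x m)) J + term w (x m) (S J)).
  { intros m. now rewrite sum_Sn. }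
  now apply is_lim_seq_plus'.
Qed.

(** Each coefficient is Cauchy because the norm dominates it up to the factor [beta w k]. The
    coefficientwise limit is a limit in norm by a Fatou argument on partial sums. *)
Lemma hardy_complete (u : nat -> hardy w) :
  (forall eps, 0 < eps -> exists N, forall m n, (N <= m)%nat -> (N <= n)%nat ->
    hardy_norm (hsub (u m) (u n)) <= eps) ->
  exists l, hlim u l.
Proof.
intros H.
destruct (functional_choice (fun k a => Clim (fun n => hardy_coef (u n) k) a)) as [a Ha].
{ intros k. apply Clim_cauchy. intros e He.
  assert (B := beta_pos w k).
  destruct (H (e * beta w k / 2)) as [N HN].
  { apply Rdiv_lt_0_compat; [now apply Rmult_lt_0_compat|lra]. }
  exists N. intros m n Hm Hn. specialize (HN m n Hm Hn).
  assert (Q := coef_le_norm w (hsub (u m) (u n)) k). rewrite hsub_coef in Q.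
  apply Rmult_lt_reg_r with (beta w k); [exact B|].
  apply Rle_lt_trans with (e * beta w k / 2); [lra|].
  assert (0 < e * beta w k) by now apply Rmult_lt_0_compat. lra. }
(* The partial sum up to a fixed [J] is continuous in finitely many coefficients, so [m] may go to
   infinity; the bound does not depend on [J]. *)
assert (D : forall eps, 0 < eps -> exists N, forall n J, (N <= n)%nat ->
  sum_n (term w (fun k => hardy_coef (u n) k - a k)%C) J <= eps ^ 2).
{ intros e He. destruct (H e He) as [N HN]. exists N. intros n J Hn.
  change (Rbar_le (sum_n (term w (fun k => hardy_coef (u n) k - a k)%C) J) (e ^ 2)).
  apply (is_lim_seq_le_loc
    (fun m => sum_n (term w (fun k => hardy_coef (u n) k - hardy_coef (u m) k)%C) J)
    (fun _ => e ^ 2)); [|apply lim_sum_term|apply is_lim_seq_const].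
  - exists N. intros m Hm. specialize (HN n m Hn Hm).
    apply Rle_trans with (hardy_norm (hsub (u n) (u m)) ^ 2).
    + rewrite <- (functional_extensionality _ _ (hsub_coef (u n) (u m))).
      apply sum_term_le_norm.
    + apply pow_incr. split; [apply hardy_norm_pos|exact HN].
  - intros k. unfold Clim. apply is_lim_seq_ext with (2 := Ha k). intros m.
    rewrite <- Cmod_opp. f_equal. ring. }
destruct (D 1 Rlt_0_1) as [N0 HN0]. specialize (HN0 N0).
assert (Sa : ex_series (term w a)).
(* The limit [a] is the coefficient sequence of [u N0] minus the difference just bounded, both
   square summable for the weight. *)
{ destruct (nonneg_series_bounded _ _ (term_pos w _) (fun J => HN0 J (le_n N0))) as [E _].
  assert (E' := ex_term_plus w _ _ (hardy_summable (u N0)) (ex_term_scal w (RtoC (-1)) _ E)).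
  apply ex_series_ext with (2 := E'). intros k. unfold term. do 3 f_equal. ring. }
destruct (hardy_of_coef w a Sa) as [l Hl].
exists l. unfold hlim. apply is_lim_seq_spec. intros [e He].
destruct (D (e / 2)) as [N HN]; [lra|]. exists N. intros n Hn. simpl.
rewrite Rminus_0_r, Rabs_pos_eq by apply hardy_norm_pos.
apply Rle_lt_trans with (e / 2); [|lra].
apply norm_le_of_sums; [lra|]. intros J.
rewrite (functional_extensionality _ _ (hsub_coef (u n) l)), Hl. now apply HN.
Qed.

Lemma hlim_eval (u : nat -> hardy w) (l : hardy w) (z : disk) :
  hlim u l -> Clim (fun n => u n z) (l z).
Proof.
intros H. destruct (hardy_eval_bound w z) as [K [HK B]].
apply is_lim_seq_squeeze_0 with (fun n => K * hardy_norm (hsub (u n) l)).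
- intros n. split; [apply Cmod_ge_0|]. rewrite <- hsub_eval. apply B.
- replace (Finite 0) with (Rbar_mult K 0) by (simpl; f_equal; ring).
  now apply is_lim_seq_scal_l.
Qed.

Lemma hlim_norm_le (u : nat -> hardy w) (l : hardy w) (A : R) :
  hlim u l -> (forall n, hardy_norm (u n) <= A) -> hardy_norm l <= A.
Proof.
intros H HA.
change (Rbar_le (hardy_norm l) A).
apply (is_lim_seq_le (fun _ => hardy_norm l) (fun n => hardy_norm (hsub (u n) l) + A)).
- intros n. assert (T := norm_le_hsub l (u n)). rewrite hsub_swap in T.
  specialize (HA n). lra.
- apply is_lim_seq_const.
- replace (Finite A) with (Finite (0 + A)) by (f_equal; ring).
  apply is_lim_seq_plus'; [exact H|apply is_lim_seq_const].
Qed.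

(** Stated through the existence of [g], so that it also asserts that [f o phi] belongs to the
    space, before any operator is available. *)
Definition comp_bounded (phi : disk -> disk) (K : R) : Prop :=
  forall f : hardy w, exists g : hardy w,
    (forall z, g z = f (phi z)) /\ hardy_norm g <= K * hardy_norm f.

Lemma comp_bounded_comp (phi psi : disk -> disk) (K L : R) : 0 <= L ->
  comp_bounded phi K -> comp_bounded psi L ->
  comp_bounded (fun z => phi (psi z)) (L * K).
Proof.
intros HL Hp Hq f. destruct (Hp f) as [g [Hg Ng]]. destruct (Hq g) as [h [Hh Nh]].
exists h. split; [intros z; now rewrite Hh, Hg|].
eapply Rle_trans; [exact Nh|]. rewrite Rmult_assoc. now apply Rmult_le_compat_l.
Qed.

Lemma comp_bounded_ext (phi psi : disk -> disk) (K L : R) : K <= L ->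
  (forall z, disk_val (phi z) = psi z) -> comp_bounded phi K -> comp_bounded psi L.
Proof.
intros HKL E H f. destruct (H f) as [g [Hg Ng]]. exists g. split.
- intros z. rewrite Hg. f_equal. specialize (E z).
  destruct (phi z), (psi z). simpl in E. subst. f_equal. apply proof_irrelevance.
- eapply Rle_trans; [exact Ng|]. apply Rmult_le_compat_r; [apply hardy_norm_pos|exact HKL].
Qed.

Definition truncate (N : nat) (a : nat -> C) (k : nat) : C :=
  if Compare_dec.le_dec k N then a k else RtoC 0.

(** The Taylor polynomials of [f] converge to [f] in norm, so their images are Cauchy. The limit of
    the images takes the values of [f o phi] because evaluation is continuous. *)
Lemma comp_bounded_dense (phi : disk -> disk) (K : R) : 0 <= K ->
  (forall (f : hardy w) N, (forall k, (N < k)%nat -> hardy_coef f k = RtoC 0) ->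
    exists g : hardy w, (forall z, g z = f (phi z)) /\ hardy_norm g <= K * hardy_norm f) ->
  comp_bounded phi K.
Proof.
intros HK H f.
set (a := hardy_coef f).
(* Pythagoras: at each index either the truncation or the remainder vanishes. *)
assert (Pt : forall N k, term w (truncate N a) k + term w (fun k => truncate N a k - a k)%C k
  = term w a k).
{ intros N k. unfold term, truncate. destruct (Compare_dec.le_dec k N).
  - replace (a k - a k)%C with (RtoC 0) by ring. rewrite Cmod_0. ring.
  - replace (RtoC 0 - a k)%C with (- a k)%C by ring. rewrite Cmod_opp, Cmod_0. ring. }
assert (Et : forall N, ex_series (term w (truncate N a))).
{ intros N. apply (@ex_series_le R_AbsRing R_CompleteNormedModule _ (term w a));
    [|apply hardy_summable].
  intros k. unfold norm; simpl. unfold abs; simpl. rewrite Rabs_pos_eq by apply term_pos.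
  rewrite <- (Pt N k). assert (T := term_pos w (fun k => truncate N a k - a k)%C k). lra. }
destruct (functional_choice (fun N (p : hardy w) => hardy_coef p = truncate N a))
  as [p Hp].
{ intros N. apply (hardy_of_coef w), Et. }
assert (Fp : forall N k, (N < k)%nat -> hardy_coef (p N) k = RtoC 0).
{ intros N k Hk. rewrite Hp. unfold truncate. destruct (Compare_dec.le_dec k N); [lia|reflexivity]. }
assert (Np : forall N, hardy_norm (p N) <= hardy_norm f).
{ intros N. apply norm_le_of_sums; [apply hardy_norm_pos|]. intros J.
  apply Rle_trans with (2 := sum_term_le_norm w f J). rewrite Hp.
  apply sum_n_m_le. intros k. fold a. rewrite <- (Pt N k).
  assert (T := term_pos w (fun k => truncate N a k - a k)%C k). lra. }
assert (Lp : hlim p f).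
{ assert (L2 : is_lim_seq (fun N => hardy_norm (hsub (p N) f) ^ 2) 0).
  { apply is_lim_seq_squeeze_0 with (fun N => Series (term w a) - sum_n (term w a) N).
    - intros N. split; [apply pow2_ge_0|].
      assert (E : hardy_norm (hsub (p N) f) ^ 2 =
        Series (term w (fun k => truncate N a k - a k)%C)).
      { unfold hardy_norm. rewrite pow2_sqrt.
        - apply Series_ext. intros k. rewrite hsub_coef, Hp. reflexivity.
        - apply (Series_term_pos w), hardy_summable. }
      rewrite E.
      rewrite (Series_ext _ (fun k => term w a k - term w (truncate N a) k)).
      2: { intros k. rewrite <- (Pt N k). ring. }
      rewrite Series_minus; [|apply hardy_summable|apply Et].
      apply Rplus_le_compat_l, Ropp_le_contravar.
      apply Rle_trans with (2 := nonneg_partial_le _ N (term_pos w _) (Et N)).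
      apply Req_le, sum_n_ext_loc. intros k Hk. unfold term, truncate.
      now destruct (Compare_dec.le_dec k N).
    - replace (Finite 0) with (Finite (Series (term w a) - Series (term w a)))
        by (f_equal; ring).
      apply is_lim_seq_minus'; [apply is_lim_seq_const|].
      apply Series_correct, hardy_summable. }
  unfold hlim. apply is_lim_seq_spec. intros e.
  apply is_lim_seq_spec in L2.
  assert (He := cond_pos e).
  assert (He2 : 0 < e ^ 2) by (apply pow_lt; exact He).
  destruct (L2 (mkposreal _ He2)) as [N HN]. exists N. intros n Hn.
  specialize (HN n Hn). simpl in HN.
  assert (P := hardy_norm_pos w (hsub (p n) f)).
  rewrite Rminus_0_r, Rabs_pos_eq by exact P.
  rewrite Rminus_0_r, Rabs_pos_eq in HN by nra. nra. }
destruct (functional_choice (fun N (g : hardy w) => (forall z, g z = p N (phi z)) /\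
  hardy_norm g <= K * hardy_norm (p N))) as [g Hg].
{ intros N. apply (H _ N), Fp. }
(* The difference of two truncations is again a polynomial, so the hypothesis applies to it;
   [hardy_ext] identifies its image with the difference of the images. *)
assert (Dg : forall m n, hardy_norm (hsub (g m) (g n)) <= K * hardy_norm (hsub (p m) (p n))).
{ intros m n. destruct (H (hsub (p m) (p n)) (max m n)) as [h [Hh Nh]].
  - intros k Hk. rewrite hsub_coef, !Fp by lia. ring.
  - replace (hsub (g m) (g n)) with h; [exact Nh|].
    apply hardy_ext; intros z. rewrite Hh, !hsub_eval.
    now rewrite (proj1 (Hg m)), (proj1 (Hg n)). }
destruct (hardy_complete g) as [l Hl].
{ intros e He. unfold hlim in Lp. apply is_lim_seq_spec in Lp.
  (* [K + 1] replaces [K] in the denominator because [K] may be 0. *)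
  assert (He' : 0 < e / (2 * (K + 1))) by (apply Rdiv_lt_0_compat; lra).
  destruct (Lp (mkposreal _ He')) as [N HN]. exists N. intros m n Hm Hn.
  assert (Am := HN m Hm). assert (An := HN n Hn). simpl in Am, An.
  rewrite Rminus_0_r, Rabs_pos_eq in Am by apply hardy_norm_pos.
  rewrite Rminus_0_r, Rabs_pos_eq in An by apply hardy_norm_pos.
  assert (T := hsub_triangle (p m) f (p n)). rewrite (hsub_swap f (p n)) in T.
  eapply Rle_trans; [apply Dg|].
  apply Rle_trans with ((K + 1) * (e / (2 * (K + 1)) + e / (2 * (K + 1)))).
  - assert (P := hardy_norm_pos w (hsub (p m) (p n))).
    apply Rmult_le_compat; lra.
  - right. field. lra. }
exists l. split.
- intros z. apply (Clim_unique (fun n => g n z)); [now apply hlim_eval|].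
  assert (E := hlim_eval _ _ (phi z) Lp). unfold Clim in *.
  apply is_lim_seq_ext with (2 := E). intros n. now rewrite (proj1 (Hg n)).
- apply (hlim_norm_le g); [exact Hl|]. intros n.
  eapply Rle_trans; [apply Hg|]. now apply Rmult_le_compat_l.
Qed.

End Completeness.

(** * Hyperbolic automorphisms *)

(* [drift] is the vector field [(1 - z^2) d/dz] acting on Taylor coefficients. *)
Definition drift (c : nat -> R) (j : nat) : R :=
  (INR j + 1) * c (S j) - match j with O => 0 | S i => INR i * c i end.

(** The transport equation of [f o h_s], written on coefficients: one has [(1 - s^2) d/ds h_s(z) =
    (1 - z^2) d/dz h_s(z)]. *)
Definition hyp_flow (c : nat -> R -> R) : Prop :=
  forall j s, -1 < s < 1 ->
    is_derive (c j) s (drift (fun i => c i s) j / (1 - s ^ 2)).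

(* Coefficients of [h_s] times the series [d], from
   [(1 + s z) (h_s d) = (s + z) d]. *)
Fixpoint mulh (s : R) (d : nat -> R) (j : nat) : R :=
  match j with
  | O => s * d O
  | S i => s * d (S i) + d i - s * mulh s d i
  end.

(** [h_s] itself solves the transport equation, and a product of two solutions of a first-order
    transport equation is a solution. On coefficients this is an induction along the recursion of
    [mulh]. *)
Lemma hyp_flow_mulh (d : nat -> R -> R) :
  hyp_flow d -> hyp_flow (fun j s => mulh s (fun i => d i s) j).
Proof.
intros Hd j s Hs.
assert (Q : 1 - s ^ 2 <> 0) by nra.
induction j as [|j IH].
- simpl mulh. specialize (Hd O s Hs).
  replace (drift (fun i => mulh s (fun i0 => d i0 s) i) 0 / (1 - s ^ 2))
    with (1 * d O s + s * (drift (fun i => d i s) 0 / (1 - s ^ 2)))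
    by (unfold drift; simpl; field; nra).
  apply (is_derive_mult (fun t => t) (d O)); [apply @is_derive_id|exact Hd|].
  intros n m; apply Rmult_comm.
- simpl mulh.
  set (m := fun i => mulh s (fun i0 => d i0 s) i) in *.
  replace (drift m (S j) / (1 - s ^ 2)) with
    (1 * d (S j) s + s * (drift (fun i => d i s) (S j) / (1 - s ^ 2))
     + drift (fun i => d i s) j / (1 - s ^ 2)
     - (1 * m j + s * (drift m j / (1 - s ^ 2)))).
  + apply (is_derive_minus (fun t => t * d (S j) t + d j t)
      (fun t => t * mulh t (fun i0 => d i0 t) j)).
    * apply (is_derive_plus (fun t => t * d (S j) t) (d j)); [|now apply Hd].
      apply (is_derive_mult (fun t => t) (d (S j))); [apply @is_derive_id|now apply Hd|].
      intros n m'; apply Rmult_comm.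
    * apply (is_derive_mult (fun t => t) (fun t => mulh t (fun i0 => d i0 t) j));
        [apply @is_derive_id|exact IH|].
      intros n m'; apply Rmult_comm.
  (* The case [j = 0] is separate because [drift] has no lower neighbour there. *)
  + unfold drift, m. destruct j as [|j].
    * simpl. field. nra.
    * rewrite !S_INR. cbn [mulh]. field. nra.
Qed.

(** In the recursion the two terms in [d] contribute at most [2 K rho^j], and the previous value of
    [mulh] is damped by [s <= sigma < rho]. The constant [K'] solves [sigma K' + 2 K = rho K'], and
    is the same for all [s] up to [sigma]. *)
Lemma mulh_bound (s sigma rho K : R) (d : nat -> R) :
  0 <= s <= sigma -> sigma < rho < 1 -> 0 <= K ->
  (forall j, Rabs (d j) <= K * rho ^ j) ->
  forall j, Rabs (mulh s d j) <= 2 * K / (rho - sigma) * rho ^ j.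
Proof.
intros Hs Hr HK Hd.
assert (Q : 2 * K / (rho - sigma) * (rho - sigma) = 2 * K) by (field; lra).
assert (P : 0 <= 2 * K / (rho - sigma)).
{ apply Rmult_le_pos; [lra|]. left. apply Rinv_0_lt_compat. lra. }
set (K' := 2 * K / (rho - sigma)) in *.
induction j as [|j IH].
- simpl. rewrite Rabs_mult, (Rabs_pos_eq s) by lra.
  specialize (Hd O). simpl in Hd. assert (0 <= Rabs (d O)) by apply Rabs_pos. nra.
- simpl mulh. simpl pow.
  assert (D1 := Hd (S j)). assert (D0 := Hd j). simpl in D1.
  assert (R0 : 0 < rho ^ j) by (apply pow_lt; lra).
  set (x := rho ^ j) in *.
  eapply Rle_trans; [apply Rabs_triang|]. rewrite Rabs_Ropp, (Rabs_mult s (mulh s d j)).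
  eapply Rle_trans; [apply Rplus_le_compat_r, Rabs_triang|].
  rewrite (Rabs_mult s (d (S j))), (Rabs_pos_eq s) by lra.
  assert (A1 : s * Rabs (d (S j)) <= K * x).
  { apply Rle_trans with (1 * (K * x)); [|lra].
    assert (0 <= K * x) by (apply Rmult_le_pos; lra).
    apply Rmult_le_compat; [lra|apply Rabs_pos|lra|]. nra. }
  assert (A2 : s * Rabs (mulh s d j) <= sigma * (K' * x)).
  { apply Rmult_le_compat; [lra|apply Rabs_pos|lra|exact IH]. }
  replace (K' * (rho * x)) with (sigma * (K' * x) + K' * (rho - sigma) * x) by ring.
  rewrite Q. lra.
Qed.

Definition hyp (s : R) (z : C) : C := ((RtoC s + z) / (1 + RtoC s * z))%C.

Lemma hyp_denom (s : R) (z : C) : 0 <= s < 1 -> Cmod z < 1 -> (1 + RtoC s * z)%C <> RtoC 0.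
Proof.
intros Hs Hz H.
assert (E : Cmod (RtoC s * z) = 1).
{ replace (RtoC s * z)%C with (- RtoC 1)%C.
  - now rewrite Cmod_opp, Cmod_1.
  - replace (RtoC s * z)%C with ((1 + RtoC s * z) - 1)%C by ring. rewrite H. ring. }
rewrite Cmod_mult, Cmod_R, Rabs_pos_eq in E by lra.
assert (0 <= Cmod z) by apply Cmod_ge_0. nra.
Qed.

Lemma hyp_solve (s : R) (z F p : C) : (1 + RtoC s * z)%C <> RtoC 0 ->
  (F + RtoC s * z * F = RtoC s * p + z * p)%C -> F = (hyp s z * p)%C.
Proof.
intros D Q. unfold hyp.
replace F with ((F + RtoC s * z * F) / (1 + RtoC s * z))%C by (field; exact D).
rewrite Q. field. exact D.
Qed.

Lemma Cmod_sqr (z : C) : Cmod z ^ 2 = fst z ^ 2 + snd z ^ 2.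
Proof. unfold Cmod. rewrite pow2_sqrt; [reflexivity|]. nra. Qed.

Lemma Cmod_hyp (s : R) (z : C) : 0 <= s < 1 -> Cmod z < 1 -> Cmod (hyp s z) < 1.
Proof.
intros Hs Hz. assert (D := hyp_denom s z Hs Hz).
unfold hyp. rewrite Cmod_div by exact D.
assert (P : 0 < Cmod (1 + RtoC s * z)) by now apply Cmod_gt_0.
apply Rlt_div_l; [exact P|]. rewrite Rmult_1_l.
assert (P' := Cmod_ge_0 (RtoC s + z)). assert (P0 := Cmod_ge_0 z).
apply Rsqr_incrst_0; [|exact P'|lra]. rewrite !Rsqr_pow2, !Cmod_sqr.
assert (Z := Cmod_sqr z). destruct z as [x y]. simpl in *.
(* This product equals [|1 + s z|^2 - |s + z|^2]. *)
assert ((1 - s * s) * (1 - (x * x + y * y)) > 0).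
{ apply Rmult_lt_0_compat; nra. }
nra.
Qed.

(** Links the formal recursion with the function: the geometric bound gives convergence to some [F],
    and [(1 + s z) F = (s + z) p] identifies it. *)
Lemma taylor_mulh (s rho K : R) (d : nat -> R) (z p : C) :
  0 <= s < rho -> rho < 1 -> 0 <= K -> Cmod z < 1 ->
  (forall j, Rabs (d j) <= K * rho ^ j) ->
  is_Cseries (fun j => RtoC (d j) * z ^ j)%C p ->
  is_Cseries (fun j => RtoC (mulh s d j) * z ^ j)%C (hyp s z * p)%C.
Proof.
intros Hs Hr HK Hz Hd Hp.
set (u := fun j => (RtoC (mulh s d j) * z ^ j)%C).
destruct (Cseries_dominated u (fun j => 2 * K / (rho - s) * rho ^ j)) as [F [HF _]].
{ intros j. unfold u. rewrite Cmod_mult, Cmod_R, Cmod_pow.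
  assert (B := mulh_bound s s rho K d ltac:(lra) ltac:(lra) HK Hd j).
  apply Rle_trans with (Rabs (mulh s d j) * 1); [|lra].
  apply Rmult_le_compat_l; [apply Rabs_pos|].
  rewrite <- (pow1 j). apply pow_incr. assert (P := Cmod_ge_0 z). lra. }
{ apply (ex_series_scal (2 * K / (rho - s)) (fun j => rho ^ j)), ex_series_geom.
  rewrite Rabs_pos_eq; lra. }
set (v := fun j => (RtoC (d j) * z ^ j)%C) in *.
(* The equation [(1 + s z) F = (s + z) p] on partial sums; with the indices shifted by one on the
   factors [z] it is exact, and survives the limit. *)
assert (E : forall n, (Csum u (S n) + RtoC s * z * Csum u n =
  RtoC s * Csum v (S n) + z * Csum v n)%C).
{ induction n as [|n IH].
  - rewrite !Csum_S, !sum_O. unfold u, v. simpl mulh. rewrite RtoC_minus, RtoC_plus, !RtoC_mult.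
    simpl. ring.
  - rewrite (Csum_S u (S n)), (Csum_S v (S n)).
    transitivity ((Csum u (S n) + RtoC s * z * Csum u n)
      + (u (S (S n)) + RtoC s * z * u (S n)))%C.
    { rewrite (Csum_S u n) at 2. ring. }
    rewrite IH.
    transitivity ((RtoC s * Csum v (S n) + z * Csum v n)
      + (RtoC s * v (S (S n)) + z * v (S n)))%C.
    2: { rewrite (Csum_S v n) at 3. ring. }
    f_equal. unfold u, v.
    change (mulh s d (S (S n))) with (s * d (S (S n)) + d (S n) - s * mulh s d (S n)).
    rewrite RtoC_minus, RtoC_plus, !RtoC_mult. simpl Cpow. ring. }
apply is_Cseries_Clim in HF. apply is_Cseries_Clim in Hp.
assert (L := Clim_plus _ _ _ _ (Clim_S _ _ HF) (Clim_scal (RtoC s * z)%C _ _ HF)).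
assert (L' := Clim_plus _ _ _ _ (Clim_scal (RtoC s) _ _ (Clim_S _ _ Hp)) (Clim_scal z _ _ Hp)).
apply (Clim_ext _ _ _ E) in L.
assert (Q := Clim_unique _ _ _ L L').
assert (D := hyp_denom s z ltac:(lra) Hz).
rewrite <- (hyp_solve s z F p D Q). now apply is_Cseries_Clim.
Qed.

Definition delta0 (x : R) (j : nat) : R := match j with O => x | S _ => 0 end.

Lemma Csum_delta0 (x : R) (z : C) (n : nat) :
  Csum (fun j => RtoC (delta0 x j) * z ^ j)%C n = RtoC x :> C.
Proof.
induction n as [|n IH]; [rewrite sum_O; simpl; ring|].
rewrite Csum_S, IH. simpl delta0. ring.
Qed.

(** Horner's scheme: if [f = f(0) + z f_1], then [f o h_s = f(0) + h_s (f_1 o h_s)], so each degree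
    costs one application of [mulh]. The geometric bound, uniform in [s], serves to remove the
    boundary term of the energy estimate. *)
Lemma poly_hyp_coefs (sigma rho : R) (n : nat) : 0 <= sigma < rho -> rho < 1 ->
  forall f : nat -> R, (forall k, (n < k)%nat -> f k = 0) ->
  exists c : nat -> R -> R,
    hyp_flow c /\ (forall j, c j 0 = f j) /\
    (exists K, 0 <= K /\ forall s j, 0 <= s <= sigma -> Rabs (c j s) <= K * rho ^ j) /\
    (forall s z, 0 <= s <= sigma -> Cmod z < 1 ->
      is_Cseries (fun j => RtoC (c j s) * z ^ j)%C
        (Csum (fun k => RtoC (f k) * hyp s z ^ k)%C n)).
Proof.
intros Hs Hr.
(* Constants are stationary: the coefficient [x] enters [drift] only at [j = 1], with the factor
   [INR 0]. *)
assert (Dd : forall x, hyp_flow (fun j _ => delta0 x j)).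
{ intros x j s H.
  replace (drift (fun i => delta0 x i) j / (1 - s ^ 2)) with 0;
    [exact (is_derive_const (delta0 x j) s)|].
  unfold drift. destruct j as [|[|j]]; simpl; field; nra. }
induction n as [|n IH]; intros f Hf.
- exists (fun j _ => delta0 (f O) j). split; [apply Dd|]. split; [|split].
  + intros [|j]; [reflexivity|]. simpl. symmetry. apply Hf. lia.
  + exists (Rabs (f O)). split; [apply Rabs_pos|]. intros s [|j] _; simpl; [lra|].
    rewrite Rabs_R0. apply Rmult_le_pos; [apply Rabs_pos|].
    apply Rmult_le_pos; [lra|]. apply pow_le; lra.
  + intros s z _ _. rewrite sum_O. apply is_Cseries_Clim.
    apply Clim_ext with (fun _ => RtoC (f O)).
    * intros n. now rewrite Csum_delta0.
    * replace (RtoC (f O) * hyp s z ^ 0)%C with (RtoC (f O)) by (simpl; ring).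
      apply Clim_const.
- destruct (IH (fun k => f (S k))) as [d [D1 [D2 [[K [HK D3]] D4]]]].
  { intros k Hk. apply Hf. lia. }
  exists (fun j s => mulh s (fun i => d i s) j + delta0 (f O) j).
  split; [|split; [|split]].
  + intros j s H.
    assert (M := hyp_flow_mulh d D1 j s H). assert (M' := Dd (f O) j s H).
    assert (P := is_derive_plus _ _ _ _ _ M M').
    refine (eq_rect _ (fun l => is_derive _ s l) P _ _).
    unfold plus; simpl. unfold drift.
    destruct j as [|j]; field; nra.
  + intros [|j]; [simpl; ring|]. simpl. rewrite (D2 j). ring.
  + exists (2 * K / (rho - sigma) + Rabs (f O)). 
    assert (P : 0 <= 2 * K / (rho - sigma)).
    { apply Rmult_le_pos; [lra|]. left. apply Rinv_0_lt_compat. lra. }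
    assert (P' := Rabs_pos (f O)).
    split; [lra|]. intros s j H.
    eapply Rle_trans; [apply Rabs_triang|]. rewrite Rmult_plus_distr_r.
    apply Rplus_le_compat.
    * apply mulh_bound with (s := s); [exact H|lra|exact HK|]. intros i. now apply D3.
    * destruct j as [|j]; [simpl; lra|]. simpl delta0. rewrite Rabs_R0.
      apply Rmult_le_pos; [exact P'|]. apply pow_le; lra.
  + intros s z H Hz. rewrite Csum_shift.
    rewrite (Csum_ext _ (fun k => hyp s z * (RtoC (f (S k)) * hyp s z ^ k))%C).
    2: { intros k. simpl. ring. }
    rewrite Csum_scal.
    assert (M := taylor_mulh s rho K (fun i => d i s) z _ ltac:(lra) Hr HK Hz
      (fun j => D3 s j H) (D4 s z H Hz)).
    apply is_Cseries_Clim in M. apply is_Cseries_Clim.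
    assert (A := Clim_plus _ _ _ _ (Clim_const (RtoC (f O))) M).
    replace (RtoC (f O) * hyp s z ^ 0)%C with (RtoC (f O)) by (simpl; ring).
    apply Clim_ext with (2 := A). intros N.
    rewrite <- (Csum_delta0 (f O) z N) at 1.
    clear. induction N as [|N IH].
    * rewrite !sum_O. rewrite RtoC_plus. ring.
    * rewrite !Csum_S, RtoC_plus, <- IH. ring.
Qed.

(** The integrating factor is [q^K] with [q = (1 - s) / (1 + s)], which satisfies
    [(1 - s^2) q' = - 2 q]. *)
Lemma gronwall (E E' : R -> R) (K : nat) (e sigma : R) :
  0 <= sigma < 1 -> 0 <= e ->
  (forall s, 0 <= s <= sigma -> is_derive E s (E' s)) ->
  (forall s, 0 <= s <= sigma -> (1 - s ^ 2) * E' s <= 2 * INR K * E s + e) ->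
  E sigma <= ((1 + sigma) / (1 - sigma)) ^ K * (E 0 + e / (1 - sigma)).
Proof.
intros Hs He HE HI.
set (q := fun s => (1 - s) / (1 + s)).
(* The alternative [s >= 1] is excluded at the point of use by [s <= sigma < 1]. *)
assert (Dq : forall s, 0 <= s -> is_derive (fun s => q s ^ K) s
  (- 2 * INR K / ((1 - s) * (1 + s)) * q s ^ K) \/ s >= 1).
{ intros s H0. destruct (Rlt_le_dec s 1) as [H1|H1]; [left|right; lra].
  assert (Q : is_derive q s (- 2 / (1 + s) ^ 2)).
  { unfold q. auto_derive; [lra|]. field. lra. }
  assert (P := is_derive_pow q K s _ Q).
  replace (- 2 * INR K / ((1 - s) * (1 + s)) * q s ^ K)
    with (INR K * (- 2 / (1 + s) ^ 2) * q s ^ Nat.pred K); [exact P|].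
  destruct K as [|k]; [simpl; unfold Rdiv; ring|].
  simpl Nat.pred. simpl (q s ^ S k). set (r := q s ^ k). unfold q. field. lra. }
(* [H] is nonincreasing: the linear term pays for the error [e], because [q^K <= 1] and
   [(1 - s) (1 + s) >= 1 - sigma]. *)
set (H := fun s => E s * q s ^ K - e / (1 - sigma) * s).
set (H' := fun s => E' s * q s ^ K + E s * (- 2 * INR K / ((1 - s) * (1 + s)) * q s ^ K)
  - e / (1 - sigma)).
assert (DH : forall s, 0 <= s <= sigma -> is_derive H s (H' s)).
{ intros s B. unfold H, H'.
  apply (is_derive_minus (fun s => E s * q s ^ K) (fun s => e / (1 - sigma) * s)).
  - apply (is_derive_mult E (fun s => q s ^ K)); [now apply HE| |].
    + destruct (Dq s (proj1 B)) as [D|D]; [exact D|lra].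
    + intros n m; apply Rmult_comm.
  - auto_derive; [exact I|]. ring. }
assert (NH : forall s, 0 <= s <= sigma -> H' s <= 0).
{ intros s B. unfold H'. specialize (HI s B).
  assert (Q0 : 0 <= q s ^ K <= 1).
  { assert (0 <= q s <= 1).
    { unfold q. split; [apply Rdiv_le_0_compat; lra|]. apply Rle_div_l; lra. }
    split; [apply pow_le; lra|]. rewrite <- (pow1 K). now apply pow_incr. }
  assert (P : 0 < (1 - s) * (1 + s)) by (apply Rmult_lt_0_compat; lra).
  replace (E' s * q s ^ K + E s * (-2 * INR K / ((1 - s) * (1 + s)) * q s ^ K))
    with (((1 - s ^ 2) * E' s - 2 * INR K * E s) * q s ^ K / ((1 - s) * (1 + s)))
    by (field; lra).
  assert (e * q s ^ K / ((1 - s) * (1 + s)) <= e / (1 - sigma)).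
  { unfold Rdiv. apply Rmult_le_compat.
    - apply Rmult_le_pos; lra.
    - left. now apply Rinv_0_lt_compat.
    - nra.
    - apply Rinv_le_contravar; [lra|]. nra. }
  assert (((1 - s ^ 2) * E' s - 2 * INR K * E s) * q s ^ K / ((1 - s) * (1 + s))
    <= e * q s ^ K / ((1 - s) * (1 + s))).
  { unfold Rdiv. apply Rmult_le_compat_r; [left; now apply Rinv_0_lt_compat|].
    apply Rmult_le_compat_r; lra. }
  lra. }
assert (M : H sigma <= H 0).
{ destruct (MVT_gen H 0 sigma H') as [c [Hc Ec]].
  - intros x Hx. rewrite Rmin_left, Rmax_right in Hx by lra. apply DH. lra.
  - intros x Hx. rewrite Rmin_left, Rmax_right in Hx by lra.
    apply continuity_pt_filterlim. apply (ex_derive_continuous H).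
    exists (H' x). now apply DH.
  - rewrite Rmin_left, Rmax_right in Hc by lra. specialize (NH c Hc).
    assert (H' c * (sigma - 0) <= 0) by nra. lra. }
unfold H in M. rewrite Rmult_0_r, Rminus_0_r in M.
replace (q 0 ^ K) with 1 in M.
2: { unfold q. replace ((1 - 0) / (1 + 0)) with 1 by field. now rewrite pow1. }
assert (I : ((1 + sigma) / (1 - sigma)) ^ K * q sigma ^ K = 1).
{ rewrite <- Rpow_mult_distr. replace (_ * q sigma) with 1; [apply pow1|].
  unfold q. field. lra. }
assert (B : 0 < ((1 + sigma) / (1 - sigma)) ^ K).
{ apply pow_lt. apply Rdiv_lt_0_compat; lra. }
assert (e / (1 - sigma) * sigma <= e / (1 - sigma) * 1).
{ apply Rmult_le_compat_l; [|lra]. apply Rdiv_le_0_compat; lra. }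
replace (E sigma) with (((1 + sigma) / (1 - sigma)) ^ K * (E sigma * q sigma ^ K)).
- apply Rmult_le_compat_l; lra.
- transitivity (E sigma * (((1 + sigma) / (1 - sigma)) ^ K * q sigma ^ K)); [ring|].
  rewrite I. ring.
Qed.

Lemma is_derive_sum_n (F : nat -> R -> R) (l : nat -> R) (N : nat) (s : R) :
  (forall k, is_derive (F k) s (l k)) ->
  is_derive (fun t => sum_n (fun k => F k t) N) s (sum_n l N).
Proof.
intros H. induction N as [|N IH].
- rewrite sum_O. apply is_derive_ext with (2 := H O). intros t. now rewrite sum_O.
- rewrite sum_Sn. apply is_derive_ext with (fun t => sum_n (fun k => F k t) N + F (S N) t).
  { intros t. now rewrite sum_Sn. }
  now apply (is_derive_plus (fun t => sum_n (fun k => F k t) N) (F (S N))).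
Qed.

(** * Energy estimate for the hyperbolic flow *)

Section Energy.
Variable w : weight.

(** The right side has the form that [2 x y <= x^2 + y^2] distributes over the two energy terms of
    index [k] and [S k]. *)
Definition skew_bound (K : R) : Prop := forall k,
  Rabs ((INR k + 1) * beta w k ^ 2 - INR k * beta w (S k) ^ 2) <= K * (beta w k * beta w (S k)).

(** With [x = w (S k)] the left side is [b^2 |1 + k (1 - x) (1 + x)|], where [k |1 - x|] is bounded
    by polynomial growth. Division by [x] is harmless because [w k] tends to 1 and so [/ w (S k)] is
    bounded. *)
Lemma polynomial_growth_skew : polynomial_growth w -> exists K : nat, skew_bound (INR K).
Proof.
intros [M HM].
destruct (filterlim_bounded (V := R_NormedModule) (fun k => / w (S k))) as [B HB].
{ exists 1. change (is_lim_seq (fun k => / w (S k)) 1).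
  replace (Finite 1) with (Rbar_inv 1) by (simpl; f_equal; field).
  apply is_lim_seq_inv; [apply weight_ratio_lim|]. intros H; injection H; lra. }
assert (Bd : exists K, forall k, / w (S k) * (1 + M) + M <= K).
{ exists (Rabs B * (1 + Rabs M) + Rabs M). intros k. specialize (HB k).
  change (Rabs (/ w (S k)) <= B) in HB.
  assert (W := weight_pos w (S k) ltac:(lia)). assert (W' := Rinv_0_lt_compat _ W).
  rewrite Rabs_pos_eq in HB by lra.
  assert (B <= Rabs B) by apply RRle_abs. assert (M <= Rabs M) by apply RRle_abs.
  assert (0 <= Rabs M) by apply Rabs_pos.
  assert (/ w (S k) * (1 + M) <= Rabs B * (1 + Rabs M)); [|lra].
  apply Rle_trans with (/ w (S k) * (1 + Rabs M)).
  - apply Rmult_le_compat_l; lra.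
  - apply Rmult_le_compat_r; lra. }
destruct Bd as [K HK].
(* The constant is rounded up to a natural number since it becomes an exponent. *)
destruct (INR_unbounded K) as [n Hn]. exists n.
intros k. specialize (HK k). specialize (HM (S k) ltac:(lia)). rewrite S_INR in HM.
assert (W := weight_pos w (S k) ltac:(lia)). assert (B' := beta_pos w k).
simpl beta. set (x := w (S k)) in *. set (b := beta w k) in *.
replace ((INR k + 1) * b ^ 2 - INR k * (b * x) ^ 2)
  with (b ^ 2 * (1 + (INR k * (1 - x)) * (1 + x))) by ring.
rewrite Rabs_mult, Rabs_pos_eq by apply pow2_ge_0.
replace (INR n * (b * (b * x))) with (b ^ 2 * (INR n * x)) by ring.
apply Rmult_le_compat_l; [apply pow2_ge_0|].
assert (P := pos_INR k). assert (P' := Rabs_pos (x - 1)).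
assert (A : Rabs (INR k * (1 - x)) <= M).
{ rewrite Rabs_mult, Rabs_pos_eq, Rabs_minus_sym by exact P. nra. }
eapply Rle_trans; [apply Rabs_triang|].
rewrite Rabs_R1, Rabs_mult, (Rabs_pos_eq (1 + x)) by lra.
apply Rle_trans with (K * x); [|apply Rmult_le_compat_r; lra].
apply Rle_trans with ((/ x * (1 + M) + M) * x); [|apply Rmult_le_compat_r; lra].
replace ((/ x * (1 + M) + M) * x) with (1 + M * (1 + x)) by (field; lra).
apply Rplus_le_compat_l. apply Rmult_le_compat_r; lra.
Qed.

(* Summation by parts: the flow is skew up to the defect measured by
   [skew_bound], apart from a boundary term at [N]. *)
Lemma energy_inequality (K : R) (c : nat -> R) (N : nat) : skew_bound K ->
  sum_n (fun k => 2 * beta w k ^ 2 * c k * drift c k) N <=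
  2 * K * sum_n (fun k => beta w k ^ 2 * c k ^ 2) N - K * (beta w N ^ 2 * c N ^ 2)
  + 2 * (INR N + 1) * beta w N ^ 2 * c N * c (S N).
Proof.
intros HK.
assert (K0 : 0 <= K).
{ specialize (HK O). assert (P := Rabs_pos ((INR 0 + 1) * beta w 0 ^ 2 - INR 0 * beta w 1 ^ 2)).
  assert (B0 := beta_pos w 0). assert (B1 := beta_pos w 1).
  assert (0 < beta w 0 * beta w 1) by now apply Rmult_lt_0_compat. nra. }
induction N as [|N IH].
- rewrite !sum_O. unfold drift. simpl INR. set (b := beta w 0).
  assert (0 <= b ^ 2 * c 0%nat ^ 2) by (apply Rmult_le_pos; apply pow2_ge_0). nra.
- rewrite !sum_n_S. specialize (HK N).
  set (B := beta w N) in *. set (B' := beta w (S N)) in *.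
  (* The boundary term at [N] and the lower part of [drift] at [S N] merge into the defect of
     skewness. It is charged in equal parts to the energies at [N] and [S N]; the share of [N] is
     the term subtracted in the induction hypothesis, so that every index pays at most twice. *)
  assert (L : 2 * (((INR N + 1) * B ^ 2 - INR N * B' ^ 2) * (c N * c (S N))) <=
    K * (B ^ 2 * c N ^ 2) + K * (B' ^ 2 * c (S N) ^ 2)).
  { eapply Rle_trans; [apply Rmult_le_compat_l; [lra|apply RRle_abs]|].
    rewrite Rabs_mult.
    apply Rle_trans with (2 * (K * (B * B') * Rabs (c N * c (S N)))).
    - apply Rmult_le_compat_l; [lra|]. apply Rmult_le_compat_r; [apply Rabs_pos|exact HK].
    - assert (P : 0 < B) by apply beta_pos. assert (P' : 0 < B') by apply beta_pos.
      rewrite <- (pow2_abs (c N)), <- (pow2_abs (c (S N))), Rabs_mult.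
      set (x := Rabs (c N)). set (y := Rabs (c (S N))).
      assert (0 <= K * (B * x - B' * y) ^ 2) by (apply Rmult_le_pos; [exact K0|apply pow2_ge_0]).
      nra. }
  rewrite S_INR. unfold drift at 2. rewrite S_INR.
  set (S1 := sum_n _ N) in *. set (S2 := sum_n _ N) in *. nra.
Qed.

(** The weights grow subexponentially: consecutive terms have ratio tending to [rho^2 < 1], so even
    their series converges. *)
Lemma beta_pow_lim (rho : R) : 0 < rho < 1 ->
  is_lim_seq (fun N => (INR N + 1) * beta w N ^ 2 * rho ^ (2 * N)) 0.
Proof.
intros Hr.
assert (P : forall N, 0 < (INR N + 1) * beta w N ^ 2 * rho ^ (2 * N)).
{ intros N. assert (I := pos_INR N). assert (B := beta_pos w N).
  apply Rmult_lt_0_compat; [apply Rmult_lt_0_compat; [lra|now apply pow_lt]|].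
  apply pow_lt; lra. }
apply ex_series_lim_0.
apply ex_series_ext with (fun N => Rabs ((INR N + 1) * beta w N ^ 2 * rho ^ (2 * N))).
{ intros N. apply Rabs_pos_eq. left. apply P. }
apply ex_series_DAlembert with (1 * (1 * 1 * rho ^ 2)).
- nra.
- intros N. apply Rgt_not_eq, P.
- apply is_lim_seq_ext with (fun N => (1 + / (INR (S N))) * (w (S N) * w (S N) * rho ^ 2)).
  { intros N. rewrite Rabs_pos_eq by (left; apply Rdiv_lt_0_compat; apply P).
    simpl beta. replace (2 * S N)%nat with (S (S (2 * N))) by lia. rewrite S_INR.
    assert (I := pos_INR N). assert (B := beta_pos w N).
    assert (0 < rho ^ (2 * N)) by (apply pow_lt; lra).
    change (rho ^ S (S (2 * N))) with (rho * (rho * rho ^ (2 * N))). field. lra. }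
  apply is_lim_seq_mult'.
  + replace (Finite 1) with (Finite (1 + 0)) by (f_equal; ring).
    apply is_lim_seq_plus'; [apply is_lim_seq_const|].
    replace (Finite 0) with (Rbar_inv p_infty) by reflexivity.
    apply is_lim_seq_inv; [|discriminate].
    apply (is_lim_seq_incr_1 INR), is_lim_seq_INR.
  + assert (L := weight_ratio_lim w).
    apply is_lim_seq_mult'; [now apply is_lim_seq_mult'|apply is_lim_seq_const].
Qed.

(** Only the energy truncated at [N] is differentiated, so no series needs termwise differentiation.
    Gronwall applies with the boundary term as error, and this error vanishes as [N] grows. *)
Lemma real_hyp_bound (K : nat) (sigma : R) (n : nat) (f : nat -> R) :
  skew_bound (INR K) -> 0 <= sigma < 1 -> (forall k, (n < k)%nat -> f k = 0) ->
  exists c : nat -> R,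
    (forall z, Cmod z < 1 ->
      is_Cseries (fun j => RtoC (c j) * z ^ j)%C
        (Csum (fun k => RtoC (f k) * hyp sigma z ^ k)%C n)) /\
    forall J, sum_n (fun k => beta w k ^ 2 * c k ^ 2) J <=
      ((1 + sigma) / (1 - sigma)) ^ K * sum_n (fun k => beta w k ^ 2 * f k ^ 2) n.
Proof.
intros HK Hs Hf. set (rho := (1 + sigma) / 2).
assert (Hr : sigma < rho < 1) by (unfold rho; lra).
destruct (poly_hyp_coefs sigma rho n ltac:(lra) ltac:(lra) f Hf)
  as [c [Hflow [H0 [[Q [HQ Hc]] Ht]]]].
exists (fun j => c j sigma). split.
{ intros z Hz. apply Ht; [lra|exact Hz]. }
set (E := fun N s => sum_n (fun k => beta w k ^ 2 * c k s ^ 2) N).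
set (A := sum_n (fun k => beta w k ^ 2 * f k ^ 2) n).
set (G := ((1 + sigma) / (1 - sigma)) ^ K).
assert (HG : 0 < G) by (apply pow_lt; apply Rdiv_lt_0_compat; lra).
(* Bounds the boundary term [2 (N + 1) beta_N^2 c_N c_{N+1}] on all of [[0, sigma]], both
   coefficients being at most [Q rho^N]. *)
set (e := fun N => 2 * Q ^ 2 * ((INR N + 1) * beta w N ^ 2 * rho ^ (2 * N))).
assert (M : forall N, E N sigma <= G * (A + e N / (1 - sigma))).
{ intros N.
  assert (e0 : 0 <= e N).
  { unfold e. assert (I := pos_INR N).
    apply Rmult_le_pos; [assert (P2 := pow2_ge_0 Q); lra|].
    apply Rmult_le_pos; [|apply pow_le; lra].
    apply Rmult_le_pos; [lra|apply pow2_ge_0]. }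
  apply Rle_trans with (G * (E N 0 + e N / (1 - sigma))).
  - apply (gronwall (E N)
      (fun s => sum_n (fun k => beta w k ^ 2 * (2 * c k s *
        (drift (fun i => c i s) k / (1 - s ^ 2)))) N)); [exact Hs|exact e0| |].
    + intros s B. unfold E. apply is_derive_sum_n. intros k.
      assert (D := Hflow k s ltac:(lra)).
      apply is_derive_scal.
      assert (D' := is_derive_pow (c k) 2 s _ D). simpl in D'.
      refine (eq_rect _ (fun l => is_derive _ s l) D' _ _). simpl. ring.
    + intros s B.
      replace ((1 - s ^ 2) * _) with
        (sum_n (fun k => 2 * beta w k ^ 2 * c k s * drift (fun i => c i s) k) N).
      2: { clear - B Hs. induction N as [|N IH].
           - rewrite !sum_O. apply Rminus_diag_uniq. field. nra.
           - rewrite !sum_n_S, IH, Rmult_plus_distr_l. apply f_equal.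
             apply Rminus_diag_uniq. field. nra. }
      eapply Rle_trans; [apply (energy_inequality (INR K) (fun i => c i s) N HK)|].
      fold (E N s).
      assert (0 <= INR K * (beta w N ^ 2 * c N s ^ 2)).
      { apply Rmult_le_pos; [apply pos_INR|]. apply Rmult_le_pos; apply pow2_ge_0. }
      assert (2 * (INR N + 1) * beta w N ^ 2 * c N s * c (S N) s <= e N); [|lra].
      unfold e. assert (I := pos_INR N). assert (P2 := pow2_ge_0 (beta w N)).
      replace (2 * Q ^ 2 * ((INR N + 1) * beta w N ^ 2 * rho ^ (2 * N)))
        with (2 * (INR N + 1) * beta w N ^ 2 * ((Q * rho ^ N) * (Q * rho ^ N)))
        by (replace (2 * N)%nat with (N + N)%nat by lia; rewrite pow_add; ring).
      rewrite (Rmult_assoc _ (c N s)).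
      apply Rmult_le_compat_l.
      { apply Rmult_le_pos; [lra|exact P2]. }
      eapply Rle_trans; [apply RRle_abs|]. rewrite Rabs_mult.
      assert (R0 : 0 <= rho ^ N) by (apply pow_le; lra).
      apply Rmult_le_compat; try apply Rabs_pos; [now apply Hc|].
      eapply Rle_trans; [now apply Hc|]. apply Rmult_le_compat_l; [exact HQ|].
      simpl. nra.
  - apply Rmult_le_compat_l; [lra|]. apply Rplus_le_compat_r.
    unfold E, A. rewrite (sum_n_ext _ (fun k => beta w k ^ 2 * f k ^ 2)).
    2: { intros k. now rewrite H0. }
    apply (sum_n_finite_support (fun k => beta w k ^ 2 * f k ^ 2)).
    + intros k. apply Rmult_le_pos; apply pow2_ge_0.
    + intros k Hk. rewrite Hf by exact Hk. ring. }
(* With [J] fixed, the truncation level [N >= J] goes to infinity. *)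
intros J. fold (E J sigma).
change (Rbar_le (E J sigma) (G * A)).
apply (is_lim_seq_le_loc (fun _ => E J sigma) (fun N => G * (A + e N / (1 - sigma)))).
- exists J. intros N HN. apply Rle_trans with (2 := M N).
  apply (sum_n_mono (fun k => beta w k ^ 2 * c k sigma ^ 2)); [|exact HN].
  intros k. apply Rmult_le_pos; apply pow2_ge_0.
- apply is_lim_seq_const.
- replace (Finite (G * A)) with (Rbar_mult G (A + (2 * Q ^ 2 * 0) * / (1 - sigma)))
    by (simpl; f_equal; ring).
  apply is_lim_seq_scal_l. apply is_lim_seq_plus'; [apply is_lim_seq_const|].
  apply is_lim_seq_mult'; [|apply is_lim_seq_const].
  apply is_lim_seq_mult'; [apply is_lim_seq_const|]. apply beta_pow_lim. lra.
Qed.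

Definition hyp_disk (sigma : R) (H : 0 <= sigma < 1) (z : disk) : disk :=
  exist _ (hyp sigma z) (Cmod_hyp sigma z H (proj2_sig z)).

(** By density [f] may be a polynomial. As [sigma] is real, real and imaginary parts of the
    coefficients evolve separately, and their energies add up to the squared norm. *)
Lemma hyp_comp_bounded (K : nat) (sigma : R) (H : 0 <= sigma < 1) :
  skew_bound (INR K) ->
  comp_bounded w (hyp_disk sigma H) (((1 + sigma) / (1 - sigma)) ^ K).
Proof.
intros HK. set (G := (1 + sigma) / (1 - sigma)).
assert (G1 : 1 <= G) by (unfold G; apply Rle_div_r; lra).
assert (GK : 1 <= G ^ K) by (apply pow_R1_Rle; exact G1).
apply comp_bounded_dense; [lra|]. intros f n Hf.
destruct (real_hyp_bound K sigma n (fun k => fst (hardy_coef f k)) HK H) as [c [Tc Bc]].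
{ intros k Hk. now rewrite Hf. }
destruct (real_hyp_bound K sigma n (fun k => snd (hardy_coef f k)) HK H) as [d [Td Bd]].
{ intros k Hk. now rewrite Hf. }
set (a := fun k => (RtoC (c k) + Ci * RtoC (d k))%C).
assert (Ea : forall k, a k = (c k, d k)).
{ intros k. unfold a. apply injective_projections; simpl; ring. }
assert (Et : forall x : nat -> C, forall J, sum_n (term w x) J =
  sum_n (fun k => beta w k ^ 2 * fst (x k) ^ 2) J + sum_n (fun k => beta w k ^ 2 * snd (x k) ^ 2) J :> R).
{ intros x J. induction J as [|J IH].
  - rewrite !sum_O. unfold term. rewrite Cmod_sqr. ring.
  - rewrite !sum_n_S, IH. unfold term. rewrite Cmod_sqr. ring. }
assert (Ba : forall J, sum_n (term w a) J <= (G ^ K * hardy_norm f) ^ 2).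
{ intros J. rewrite Et.
  rewrite (sum_n_ext (fun k => beta w k ^ 2 * fst (a k) ^ 2) (fun k => beta w k ^ 2 * c k ^ 2))
    by (intros k; now rewrite Ea).
  rewrite (sum_n_ext (fun k => beta w k ^ 2 * snd (a k) ^ 2) (fun k => beta w k ^ 2 * d k ^ 2))
    by (intros k; now rewrite Ea).
  specialize (Bc J). specialize (Bd J). fold G in Bc, Bd.
  assert (T := sum_term_le_norm w f n). rewrite Et in T.
  apply Rle_trans with (G ^ K * hardy_norm f ^ 2).
  - eapply Rle_trans; [apply Rplus_le_compat; eassumption|].
    rewrite <- Rmult_plus_distr_l. apply Rmult_le_compat_l; [lra|exact T].
  (* The squared norm grows by at most [G ^ K], which is replaced by the larger [(G ^ K) ^ 2]; hence
     the factor [G ^ K] for the norm itself. *)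
  - rewrite Rpow_mult_distr. apply Rmult_le_compat_r; [apply pow2_ge_0|]. nra. }
destruct (hardy_of_coef w a) as [g Hg].
{ apply (nonneg_series_bounded _ _ (term_pos w a) Ba). }
exists g. split.
- intros z. apply (is_Cseries_unique _ _ _ (proj1 (taylor_Cseries _ _) (hardy_taylor g) z)).
  rewrite Hg.
  assert (Ef : f (hyp_disk sigma H z) =
    Csum (fun k => hardy_coef f k * hyp sigma z ^ k)%C n).
  { apply (Clim_unique (Csum (fun k => hardy_coef f k * hyp sigma z ^ k)%C)).
    - apply is_Cseries_Clim.
      exact (proj1 (taylor_Cseries _ _) (hardy_taylor f) (hyp_disk sigma H z)).
    - unfold Clim. apply is_lim_seq_ext_loc with (fun _ => 0); [|apply is_lim_seq_const].
      exists n. intros N HN.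
      assert (St : Csum (fun k => hardy_coef f k * hyp sigma z ^ k)%C N
        = Csum (fun k => hardy_coef f k * hyp sigma z ^ k)%C n :> C).
      { induction HN as [|N HN IH]; [reflexivity|]. rewrite Csum_S, IH, Hf by lia. ring. }
      rewrite St, <- Cmod_0. f_equal. ring. }
  rewrite Ef.
  assert (Tc' := proj1 (is_Cseries_Clim _ _) (Tc z (proj2_sig z))).
  assert (Td' := proj1 (is_Cseries_Clim _ _) (Td z (proj2_sig z))).
  apply is_Cseries_Clim.
  assert (P := Clim_plus _ _ _ _ Tc' (Clim_scal Ci _ _ Td')).
  assert (Comb : forall (x y : nat -> C) N,
    Csum (fun k => x k + Ci * y k)%C N = (Csum x N + Ci * Csum y N)%C :> C).
  { intros x y N. induction N as [|N IH]; [now rewrite !sum_O|].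
    rewrite !Csum_S, IH. ring. }
  replace (Csum (fun k => hardy_coef f k * hyp sigma z ^ k)%C n) with
    (Csum (fun k => RtoC (fst (hardy_coef f k)) * hyp sigma z ^ k
      + Ci * (RtoC (snd (hardy_coef f k)) * hyp sigma z ^ k))%C n).
  + rewrite Comb. apply Clim_ext with (2 := P). intros N. rewrite <- Comb. apply Csum_ext.
    intros k. unfold a. ring.
  + apply Csum_ext. intros k.
    transitivity ((RtoC (fst (hardy_coef f k)) + Ci * RtoC (snd (hardy_coef f k)))
      * hyp sigma z ^ k)%C; [ring|].
    f_equal. apply injective_projections; simpl; ring.
- apply norm_le_of_sums.
  + apply Rmult_le_pos; [lra|apply hardy_norm_pos].
  + rewrite Hg. exact Ba.
Qed.

End Energy.

(** * Parabolic automorphisms *)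

Lemma Cmod_unit_mult (u z : C) : Cmod u = 1 -> Cmod z < 1 -> Cmod (u * z) < 1.
Proof. intros Hu Hz. rewrite Cmod_mult, Hu. lra. Qed.

Definition rot (u : C) (Hu : Cmod u = 1) (z : disk) : disk :=
  exist _ (u * z)%C (Cmod_unit_mult u z Hu (proj2_sig z)).

(** A rotation multiplies the coefficient of index [k] by the unimodular number [u ^ k], hence acts
    isometrically for every weight. *)
Lemma rot_comp_bounded (w : weight) (u : C) (Hu : Cmod u = 1) : comp_bounded w (rot u Hu) 1.
Proof.
intros f.
set (a := fun k => (hardy_coef f k * u ^ k)%C).
assert (E : term w a = term w (hardy_coef f)).
{ apply functional_extensionality. intros k. unfold term, a.
  rewrite Cmod_mult, Cmod_pow, Hu, pow1. ring. }
destruct (hardy_of_coef w a) as [g Hg].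
{ rewrite E. apply hardy_summable. }
exists g. split.
- intros z. apply (is_Cseries_unique _ _ _ (proj1 (taylor_Cseries _ _) (hardy_taylor g) z)).
  apply (is_series_ext (V := C_NormedModule)) with
    (2 := proj1 (taylor_Cseries _ _) (hardy_taylor f) (rot u Hu z)).
  intros k. rewrite Hg. unfold a. simpl disk_val. rewrite Cpow_mult_l.
  apply Cmult_assoc.
- right. rewrite Rmult_1_l. unfold hardy_norm. fold (term w (hardy_coef g)).
  change (sqrt (Series (term w (hardy_coef g))) = sqrt (Series (term w (hardy_coef f)))).
  now rewrite Hg, E.
Qed.

Lemma Ci_sqr : (Ci * Ci)%C = (- RtoC 1)%C.
Proof. apply injective_projections; simpl; ring. Qed.

Lemma Cconj_unit (z : C) : Cmod z = 1 -> (Cconj z * z)%C = RtoC 1.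
Proof.
intros H. assert (E := Cmod_sqr z). rewrite H in E. destruct z as [x y]. simpl in E.
apply injective_projections; simpl; lra.
Qed.

Lemma disk_away (zeta : C) (z : disk) : Cmod zeta = 1 -> (1 - Cconj zeta * z)%C <> RtoC 0.
Proof.
intros Hz H.
assert (E : (Cconj zeta * z)%C = RtoC 1).
{ replace (Cconj zeta * z)%C with (1 - (1 - Cconj zeta * z))%C by ring. rewrite H. ring. }
apply (f_equal Cmod) in E. rewrite Cmod_mult, Cmod_conj, Hz, Cmod_1 in E.
destruct z as [z P]. simpl in E. lra.
Qed.

Lemma Cmod_one_plus_Ci (c : R) : Cmod (1 + RtoC c * Ci) = sqrt (1 + c ^ 2).
Proof. unfold Cmod. f_equal. simpl. ring. Qed.

(* In the coordinate [1 / (1 - Cconj zeta * z)] on a half-plane, the parabolic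
   automorphisms fixing [zeta] are the imaginary translations; each of them is
   a hyperbolic automorphism between two rotations. *)
Lemma imaginary_shift (w : weight) (K : nat) (zeta : C) (c : R) :
  skew_bound w (INR K) -> Cmod zeta = 1 ->
  exists psi : disk -> disk,
    (forall z, / (1 - Cconj zeta * psi z) = / (1 - Cconj zeta * z) + RtoC c * Ci)%C /\
    comp_bounded w psi ((4 * (1 + c ^ 2)) ^ K).
Proof.
intros HK Hz.
set (r := sqrt (1 + c ^ 2)). set (q := (1 + RtoC c * Ci)%C).
assert (c2 := pow2_ge_0 c).
assert (r2 : r * r = 1 + c ^ 2) by (apply sqrt_sqrt; lra).
assert (rp : 0 < r) by (apply sqrt_lt_R0; lra).
assert (Hq : Cmod q = r) by apply Cmod_one_plus_Ci.
assert (q0 : q <> RtoC 0) by (apply Cmod_gt_0; lra).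
(* [e] is the sign of [c], taken to be 1 when [c = 0]. *)
assert (He : exists e, e * e = 1 /\ Rabs c = e * c).
{ destruct (Rle_lt_dec 0 c) as [P|P].
  - exists 1. rewrite Rabs_pos_eq by exact P. lra.
  - exists (-1). rewrite Rabs_left by exact P. lra. }
destruct He as [e [e2 He]].
assert (Re : Rabs e = 1).
{ destruct (Rle_lt_dec 0 e) as [P|P]; [rewrite Rabs_pos_eq by exact P|rewrite Rabs_left by exact P];
  nra. }
set (sigma := Rabs c / r).
assert (Sr : sigma * r = e * c) by (unfold sigma; rewrite He; field; lra).
assert (Hs : 0 <= sigma < 1).
{ unfold sigma. split; [apply Rdiv_le_0_compat; [apply Rabs_pos|exact rp]|].
  apply Rlt_div_l; [exact rp|]. rewrite Rmult_1_l.
  apply Rsqr_incrst_0; [|apply Rabs_pos|lra]. rewrite <- Rsqr_abs, !Rsqr_pow2.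
  simpl in *. lra. }
(* The rotations are unimodular because [|q| = r]. They are chosen so that
   [sigma v = - i c Cconj zeta / q] and [u v = (1 - i c) / q]. *)
set (u := (RtoC e * Ci * zeta * RtoC r / q)%C).
set (v := (- RtoC e * Ci * Cconj zeta * RtoC r / q)%C).
assert (Hu : Cmod u = 1).
{ unfold u. rewrite Cmod_div, !Cmod_mult, Hz, Cmod_Ci, !Cmod_R, Re, Hq, Rabs_pos_eq by (lra || exact q0).
  field. lra. }
assert (Hv : Cmod v = 1).
{ unfold v. rewrite Cmod_div, !Cmod_mult, Cmod_opp, Cmod_conj, Hz, Cmod_Ci, !Cmod_R, Re, Hq,
    Rabs_pos_eq by (lra || exact q0). field. lra. }
exists (fun z => rot u Hu (hyp_disk sigma Hs (rot v Hv z))). split.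
- intros z. assert (Z := disk_away zeta z Hz). assert (ZZ := Cconj_unit zeta Hz).
  simpl disk_val. unfold hyp.
  set (D := (1 + RtoC sigma * (v * z))%C).
  assert (D0 : D <> RtoC 0).
  { apply hyp_denom; [exact Hs|]. apply Cmod_unit_mult; [exact Hv|apply (proj2_sig z)]. }
  assert (E2 : (RtoC e * RtoC e)%C = RtoC 1) by (rewrite <- RtoC_mult; now f_equal).
  assert (SR : (RtoC sigma * RtoC r)%C = (RtoC e * RtoC c)%C)
    by (rewrite <- !RtoC_mult; now f_equal).
  assert (RR : (RtoC r * RtoC r)%C = ((1 + RtoC c * Ci) * (1 - RtoC c * Ci))%C).
  { rewrite <- RtoC_mult, r2. apply injective_projections; simpl; ring. }
  assert (A1 : (RtoC sigma * v)%C = (- (RtoC c * Ci * Cconj zeta) / q)%C).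
  { unfold v. transitivity (- (RtoC e * (RtoC sigma * RtoC r) * Ci * Cconj zeta) / q)%C;
      [field; exact q0|]. rewrite SR.
    transitivity (- ((RtoC e * RtoC e) * RtoC c * Ci * Cconj zeta) / q)%C;
      [field; exact q0|]. rewrite E2. field. exact q0. }
  assert (A2 : (Cconj zeta * u * RtoC sigma)%C = (RtoC c * Ci / q)%C).
  { unfold u. transitivity (RtoC e * (RtoC sigma * RtoC r) * Ci * (Cconj zeta * zeta) / q)%C;
      [field; exact q0|]. rewrite SR, ZZ.
    transitivity ((RtoC e * RtoC e) * RtoC c * Ci / q)%C;
      [field; exact q0|]. rewrite E2. field. exact q0. }
  assert (A3 : (u * v)%C = ((1 - RtoC c * Ci) / q)%C).
  { unfold u, v.
    transitivity (- (RtoC e * RtoC e) * (Ci * Ci) * (Cconj zeta * zeta) * (RtoC r * RtoC r) / (q * q))%C;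
      [field; exact q0|]. rewrite E2, Ci_sqr, ZZ, RR. fold q. field. exact q0. }
  assert (N : (1 - Cconj zeta * (u * ((RtoC sigma + v * z) / D)))%C
    = ((1 - Cconj zeta * z) / (q * D))%C).
  { transitivity ((D - Cconj zeta * u * RtoC sigma - Cconj zeta * (u * v) * z) / D)%C;
      [field; exact D0|].
    rewrite A2, A3. unfold D at 1. rewrite Cmult_assoc, A1.
    unfold q at 1 2. unfold q in q0 |- *. field. now split. }
  rewrite N.
  (* Here [q D = 1 + i c (1 - Cconj zeta z)], so the quotient is the old coordinate plus [i c]. *)
  transitivity (q * D / (1 - Cconj zeta * z))%C; [field; repeat split; assumption|].
  unfold D. rewrite (Cmult_assoc (RtoC sigma)), A1. unfold q in q0 |- *. field. now split.
- set (G := (1 + sigma) / (1 - sigma)).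
  assert (G0 : 0 < G) by (apply Rdiv_lt_0_compat; lra).
  (* Since [(1 - sigma^2) r^2 = 1], one has [G = (1 + sigma)^2 r^2 <= 4 r^2]. *)
  assert (HG : G <= 4 * (1 + c ^ 2)).
  { unfold G. apply Rle_div_l; [lra|]. rewrite <- r2.
    assert (Sc : (sigma * r) * (sigma * r) = c ^ 2) by (rewrite Sr; transitivity ((e * e) * c ^ 2); [ring|rewrite e2; ring]).
    assert (S2 : (1 - sigma * sigma) * (r * r) = 1) by nra.
    assert (1 <= (1 + sigma) * ((1 - sigma) * (r * r))) by nra.
    assert (0 <= (1 - sigma) * (r * r)) by nra.
    nra. }
  apply comp_bounded_ext with
    (phi := fun z => rot u Hu (hyp_disk sigma Hs (rot v Hv z))) (K := 1 * (G ^ K * 1)).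
  + rewrite Rmult_1_l, Rmult_1_r. apply pow_incr. lra.
  + reflexivity.
  + apply (comp_bounded_comp w (fun z => rot u Hu (hyp_disk sigma Hs z)) (rot v Hv)); [lra| |].
    * apply (comp_bounded_comp w (rot u Hu) (hyp_disk sigma Hs)); [left; now apply pow_lt| |].
      -- apply rot_comp_bounded.
      -- now apply hyp_comp_bounded.
    * apply rot_comp_bounded.
Qed.

(** * Normal form of a parabolic automorphism *)

Lemma Cmod_expi (theta : R) : Cmod (expi theta) = 1.
Proof.
unfold Cmod, expi. simpl. rewrite !Rmult_1_r, <- sqrt_1. apply f_equal.
rewrite Rplus_comm. exact (sin2_cos2 theta).
Qed.

Lemma moebius_minus_id (theta : R) (z0 z : C) : (1 - Cconj z0 * z)%C <> RtoC 0 ->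
  ((moebius theta z0 z - z) * (1 - Cconj z0 * z) =
   Cconj z0 * z * z - (1 + expi theta) * z + expi theta * z0)%C.
Proof. intros H. unfold moebius. field. exact H. Qed.

(* The numerator of [moebius theta z0 z - z] is a quadratic polynomial, so a
   double zero at [zeta] gives [moebius theta z0 z - z = Cconj z0 * (z - zeta) ^ 2
   / (1 - Cconj z0 * z)]. *)
Lemma double_fixed_point (theta : R) (z0 : disk) (zeta : C) : Cmod zeta = 1 ->
  zero_of_order (fun z => moebius theta z0 z - z)%C zeta 2 ->
  disk_val z0 <> RtoC 0 /\ (1 + expi theta = 2 * (Cconj z0 * zeta))%C /\
  (expi theta * z0 = Cconj z0 * zeta * zeta)%C.
Proof.
intros Hz [h [Ch [h0 Hh]]].
set (p := Cconj z0) in *. set (E := expi theta) in *.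
assert (Hp : Cmod p < 1) by (unfold p; rewrite Cmod_conj; apply (proj2_sig z0)).
(* The double zero is tested only along the real increments [zeta + t]; these suffice to determine a
   quadratic polynomial. *)
assert (Bh : forall eps : posreal, exists d : posreal, forall t, Rabs t < d ->
  Cmod (h (zeta + RtoC t)%C - h zeta) < eps /\
  (moebius theta z0 (zeta + RtoC t) - (zeta + RtoC t) = RtoC t ^ 2 * h (zeta + RtoC t)%C)%C).
{ intros eps.
  assert (L1 : locally zeta (fun y => Cmod (h y - h zeta) < eps)).
  { apply (Ch (fun y : C => Cmod (y - h zeta) < eps)).
    apply (locally_le_locally_norm (V := C_NormedModule)).
    exists eps. intros y Hy. exact Hy. }
  destruct (filter_and _ _ L1 Hh) as [d Hd]. exists d. intros t Ht.
  destruct (Hd (zeta + RtoC t)%C) as [D1 D2].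
  - split; simpl; unfold ball; simpl; unfold AbsRing_ball, abs, minus, plus, opp; simpl.
    + now replace (fst zeta + t + - fst zeta) with t by ring.
    + replace (snd zeta + 0 + - snd zeta) with 0 by ring. rewrite Rabs_R0. apply cond_pos.
  - split; [exact D1|]. rewrite D2. f_equal. f_equal. ring. }
assert (Dn : forall t, 0 <= t -> t < 1 - Cmod p -> (1 - p * (zeta + RtoC t))%C <> RtoC 0).
{ intros t Ht0 Ht H.
  assert (F : (p * (zeta + RtoC t))%C = RtoC 1).
  { replace (p * (zeta + RtoC t))%C with (1 - (1 - p * (zeta + RtoC t)))%C by ring.
    rewrite H. ring. }
  apply (f_equal Cmod) in F. rewrite Cmod_1, Cmod_mult in F.
  assert (T := Cmod_triangle zeta (RtoC t)). rewrite Hz, Cmod_R, Rabs_pos_eq in T by exact Ht0.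
  assert (P := Cmod_ge_0 p). nra. }
destruct (Bh (mkposreal 1 Rlt_0_1)) as [d Hd]. simpl in Hd.
set (H := Cmod (h zeta) + 1).
assert (H1 : 0 < H) by (unfold H; assert (P := Cmod_ge_0 (h zeta)); lra).
set (Q := fun z : C => (p * z * z - (1 + E) * z + E * z0)%C).
(* The numerator [Q] is [O(t^2)] at [zeta]; the factor 3 bounds [|1 - p (zeta + t)|]. *)
assert (BQ : forall t, 0 <= t < d -> t < 1 - Cmod p ->
  Cmod (Q (zeta + RtoC t)%C) <= t ^ 2 * H * 3).
{ intros t Ht Ht'. destruct (Hd t) as [D1 D2]; [rewrite Rabs_pos_eq; lra|].
  assert (M := moebius_minus_id theta z0 (zeta + RtoC t)%C (Dn t (proj1 Ht) Ht')).
  fold p E in M. unfold Q. rewrite <- M, D2.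
  rewrite (Cmod_mult (RtoC t ^ 2 * h (zeta + RtoC t)%C)), (Cmod_mult (RtoC t ^ 2)).
  rewrite Cmod_pow, Cmod_R, Rabs_pos_eq by lra.
  assert (A : Cmod (h (zeta + RtoC t)%C) <= H).
  { unfold H. assert (T := Cmod_triangle (h (zeta + RtoC t)%C - h zeta) (h zeta)).
    replace (h (zeta + RtoC t)%C - h zeta + h zeta)%C with (h (zeta + RtoC t)%C) in T by ring. lra. }
  assert (B : Cmod (1 - p * (zeta + RtoC t)) <= 3).
  { eapply Rle_trans; [apply Cmod_triangle|]. rewrite Cmod_1, Cmod_opp, Cmod_mult.
    assert (T := Cmod_triangle zeta (RtoC t)). rewrite Hz, Cmod_R, Rabs_pos_eq in T by lra.
    assert (P := Cmod_ge_0 p). assert (P' := Cmod_ge_0 (zeta + RtoC t)). nra. }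
  apply Rmult_le_compat; [|apply Cmod_ge_0| |exact B].
  - apply Rmult_le_pos; [apply pow2_ge_0|apply Cmod_ge_0].
  - apply Rmult_le_compat_l; [apply pow2_ge_0|exact A]. }
assert (dp := cond_pos d).
assert (Q0 : Q zeta = RtoC 0).
{ apply Cmod_eq_0. assert (B := BQ 0 ltac:(lra) ltac:(lra)).
  replace (zeta + RtoC 0)%C with zeta in B by ring.
  assert (P := Cmod_ge_0 (Q zeta)). lra. }
(* This is [Q'(zeta) = 0]: as [Q(zeta) = 0], one has [Q(zeta + t) = t (X + t p)], which is [O(t^2)]
   only if [X = 0]. *)
assert (Q1 : (2 * (p * zeta) - (1 + E))%C = RtoC 0).
{ apply Cmod_eq_0. set (X := (2 * (p * zeta) - (1 + E))%C).
  assert (XP := Cmod_ge_0 X).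
  destruct (Rle_lt_dec (Cmod X) 0) as [|XN]; [lra|exfalso].
  (* The last bound forces [|X| <= t (3 H + 1) <= |X| / 2], impossible for [X] nonzero. *)
  set (t := Rmin (Rmin (d / 2) ((1 - Cmod p) / 2)) (Cmod X / (2 * (3 * H + 1)))).
  assert (t0 : 0 < t).
  { unfold t. repeat apply Rmin_glb_lt; try lra. apply Rdiv_lt_0_compat; lra. }
  assert (ta : t <= d / 2 /\ t <= (1 - Cmod p) / 2 /\ t <= Cmod X / (2 * (3 * H + 1))).
  { unfold t. repeat split.
    - eapply Rle_trans; [apply Rmin_l|apply Rmin_l].
    - eapply Rle_trans; [apply Rmin_l|apply Rmin_r].
    - apply Rmin_r. }
  destruct ta as [ta [tb tc]].
  assert (B := BQ t ltac:(lra) ltac:(lra)).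
  replace (Q (zeta + RtoC t)%C) with (RtoC t * (X + RtoC t * p))%C in B.
  2: { transitivity (Q zeta + RtoC t * (X + RtoC t * p))%C; [rewrite Q0; ring|].
       unfold Q, X. ring. }
  rewrite Cmod_mult, Cmod_R, Rabs_pos_eq in B by lra.
  assert (T := Cmod_triangle (X + RtoC t * p) (- (RtoC t * p))).
  replace (X + RtoC t * p + - (RtoC t * p))%C with X in T by ring.
  rewrite Cmod_opp, Cmod_mult, Cmod_R, Rabs_pos_eq in T by lra.
  assert (B' : Cmod (X + RtoC t * p) <= t * H * 3).
  { apply Rmult_le_reg_l with t; [exact t0|]. nra. }
  assert (tc' : t * (2 * (3 * H + 1)) <= Cmod X).
  { apply Rle_div_r in tc; [exact tc|lra]. }
  assert (P := Cmod_ge_0 p). nra. }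
assert (E1 : (1 + E)%C = (2 * (p * zeta))%C).
{ replace (1 + E)%C with (2 * (p * zeta) - (2 * (p * zeta) - (1 + E)))%C by ring.
  rewrite Q1. ring. }
assert (E0 : (E * z0)%C = (p * zeta * zeta)%C).
{ transitivity (Q zeta - p * zeta * zeta + (1 + E) * zeta)%C; [unfold Q; ring|].
  rewrite Q0, E1. ring. }
split; [|now split].
(* If [z0 = 0], then [p = 0] and [E = -1], so the Moebius map is the identity and [h] vanishes at
   points arbitrarily close to [zeta]. *)
intros Z. apply h0. apply Cmod_eq_0.
assert (p0 : p = RtoC 0).
{ unfold p. rewrite Z. apply injective_projections; simpl; ring. }
destruct (Rle_lt_dec (Cmod (h zeta)) 0) as [|HN]; [assert (P := Cmod_ge_0 (h zeta)); lra|exfalso].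
destruct (Bh (mkposreal _ HN)) as [d' Hd']. simpl in Hd'.
assert (dp' := cond_pos d'). set (t := d' / 2).
destruct (Hd' t) as [D1 D2]; [unfold t; rewrite Rabs_pos_eq; lra|].
assert (M : (moebius theta z0 (zeta + RtoC t) - (zeta + RtoC t) = 0)%C).
{ unfold moebius. fold p E. rewrite Z, p0.
  assert (Em : E = (- RtoC 1)%C).
  { replace E with (1 + E - 1)%C by ring. rewrite E1, p0. ring. }
  rewrite Em. field. }
rewrite M in D2.
assert (HT : h (zeta + RtoC t)%C = RtoC 0).
{ assert (t0 : RtoC t <> RtoC 0).
  { intros F. apply (f_equal fst) in F. simpl in F. unfold t in F. lra. }
  transitivity ((RtoC t ^ 2 * h (zeta + RtoC t)) / RtoC t ^ 2)%C; [field; exact t0|].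
  simpl in D2 |- *. rewrite <- D2. field. exact t0. }
rewrite HT in D1. replace (0 - h zeta)%C with (- h zeta)%C in D1 by ring.
rewrite Cmod_opp in D1. lra.
Qed.

(** With [q = Cconj z0 zeta], the double fixed point gives [expi theta = 2 q - 1], and the
    coordinate is translated by [q / (1 - q)]. From [|2 q - 1| = 1] follows [|q|^2 = Re q], which
    makes this number purely imaginary; it is nonzero since [z0] is. *)
Lemma parabolic_normal_form (phi : disk -> disk) : parabolic_disk_automorphism phi ->
  exists (zeta : C) (b : R), Cmod zeta = 1 /\ b <> 0 /\ forall z : disk,
    (/ (1 - Cconj zeta * phi z) = / (1 - Cconj zeta * z) + RtoC b * Ci)%C.
Proof.
intros [theta [z0 [Hphi [zeta [Hz [Hzero _]]]]]].
destruct (double_fixed_point theta z0 zeta Hz Hzero) as [Z0 [E1 E0]].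
set (q := (Cconj z0 * zeta)%C) in *. set (E := expi theta) in *.
assert (Hq : Cmod q < 1).
{ unfold q. rewrite Cmod_mult, Cmod_conj, Hz, Rmult_1_r. apply (proj2_sig z0). }
assert (q1 : (1 - q)%C <> RtoC 0).
{ intros F. assert (G : q = RtoC 1) by (replace q with (1 - (1 - q))%C by ring; rewrite F; ring).
  rewrite G, Cmod_1 in Hq. lra. }
assert (EE : E = (2 * q - 1)%C) by (replace E with (1 + E - 1)%C by ring; now rewrite E1).
set (y := (q / (1 - q))%C).
assert (Hy : fst y = 0).
{ assert (ME := Cmod_expi theta). fold E in ME.
  assert (M2 := Cmod_sqr E). rewrite ME, EE in M2.
  unfold y. destruct q as [a b]. simpl in M2 |- *.
  assert (D : (1 + - a) * (1 + - a) + (0 + - b) * (0 + - b) <> 0).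
  { intros F. apply q1. apply injective_projections; simpl; nra. }
  assert (S : a * a + b * b = a) by nra.
  unfold Rdiv. rewrite !Rmult_1_r.
  transitivity ((a - (a * a + b * b)) * / ((1 + - a) * (1 + - a) + (0 + - b) * (0 + - b)));
    [field; intros F; apply D; etransitivity; [|exact F]; ring|]. rewrite S. ring. }
exists zeta, (snd y). split; [exact Hz|]. split.
- intros F. apply Z0.
  assert (y0 : y = RtoC 0) by (apply injective_projections; simpl; assumption).
  assert (Q0 : q = RtoC 0).
  { replace q with (y * (1 - q))%C by (unfold y; field; exact q1). rewrite y0. ring. }
  apply Cmod_eq_0. apply (f_equal Cmod) in Q0.
  unfold q in Q0. rewrite Cmod_mult, Cmod_conj, Hz, Cmod_0 in Q0. lra.
- intros z.
  assert (Yi : (RtoC (snd y) * Ci)%C = y).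
  { clearbody y. destruct y as [y1 y2]. simpl in Hy. subst y1.
    apply injective_projections; simpl; ring. }
  rewrite Yi. unfold y.
  assert (ZZ := Cconj_unit zeta Hz).
  assert (A := disk_away zeta z Hz). assert (A' := disk_away zeta (phi z) Hz).
  assert (D : (1 - Cconj z0 * z)%C <> RtoC 0).
  { intros F. assert (G : (Cconj z0 * z)%C = RtoC 1).
    { replace (Cconj z0 * z)%C with (1 - (1 - Cconj z0 * z))%C by ring. rewrite F. ring. }
    apply (f_equal Cmod) in G. rewrite Cmod_mult, Cmod_conj, Cmod_1 in G.
    assert (P := proj2_sig z0). assert (P' := proj2_sig z). simpl in P, P'.
    assert (P0 := Cmod_ge_0 z0). assert (P0' := Cmod_ge_0 z).
    unfold disk_val in *. nra. }
  assert (QD : (1 - Cconj z0 * z = 1 - q * (Cconj zeta * z))%C).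
  { unfold q. transitivity (1 - Cconj z0 * (Cconj zeta * zeta) * z)%C; [rewrite ZZ; ring|ring]. }
  assert (V : (1 - Cconj zeta * phi z)%C
    = ((1 - q) * (1 - Cconj zeta * z) / (1 - Cconj z0 * z))%C).
  { rewrite (Hphi z). unfold moebius. fold E.
    transitivity ((1 - Cconj z0 * z - Cconj zeta * (E * z0) + E * (Cconj zeta * z))
      / (1 - Cconj z0 * z))%C; [field; exact D|].
    f_equal. rewrite E0.
    transitivity (1 - Cconj z0 * z - Cconj z0 * (Cconj zeta * zeta) * zeta
      + E * (Cconj zeta * z))%C; [unfold q; ring|].
    rewrite QD, ZZ, EE. fold q. unfold q. ring. }
  rewrite V, QD. rewrite QD in D. field. repeat split; assumption.
Qed.

(** * Resolvents *)

Lemma disk_eq (y z : disk) : disk_val y = disk_val z -> y = z.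
Proof. destruct y, z. simpl. intros ->. f_equal. apply proof_irrelevance. Qed.

Section Series.
Variable w : weight.

Fixpoint psum (g : nat -> hardy w) (n : nat) : hardy w :=
  match n with O => g O | S m => hardy_plus w (psum g m) (g (S m)) end.

Lemma psum_eval (g : nat -> hardy w) (n : nat) (z : disk) :
  psum g n z = Csum (fun k => g k z) n :> C.
Proof.
induction n as [|n IH]; [now rewrite sum_O|]. rewrite Csum_S, <- IH. reflexivity.
Qed.

(** Absolute convergence in a complete space; the sum may be read off pointwise because evaluation
    is continuous. *)
Lemma hardy_series (g : nat -> hardy w) (v : nat -> R) :
  (forall n, hardy_norm (g n) <= v n) -> ex_series v ->
  exists l : hardy w, hardy_norm l <= Series v /\
    forall z, is_Cseries (fun n => g n z) (l z).
Proof.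
intros Hg Hv.
assert (v0 : forall k, 0 <= v k).
{ intros k. apply Rle_trans with (2 := Hg k), hardy_norm_pos. }
assert (Nd : forall n m, hardy_norm (hsub w (psum g (n + m)) (psum g n)) <=
  sum_n v (n + m) - sum_n v n).
{ intros n m. induction m as [|m IH].
  - rewrite Nat.add_0_r. right.
    replace (hsub w (psum g n) (psum g n)) with (hardy_zero w).
    + rewrite hardy_norm_zero. ring.
    + apply hardy_ext. intros z. rewrite hsub_eval. simpl. ring.
  - rewrite Nat.add_succ_r, sum_n_S.
    eapply Rle_trans; [apply (hsub_triangle w _ (psum g (n + m)))|].
    replace (hsub w (psum g (S (n + m))) (psum g (n + m))) with (g (S (n + m))).
    + specialize (Hg (S (n + m))). lra.
    + apply hardy_ext. intros z. rewrite hsub_eval, !psum_eval, Csum_S. ring. }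
destruct (hardy_complete w (psum g)) as [l Hl].
{ intros e He. assert (L := Series_correct _ Hv).
  assert (L' : is_lim_seq (sum_n v) (Series v)) by exact L.
  apply is_lim_seq_spec in L'. destruct (L' (mkposreal _ He)) as [N HN]. simpl in HN.
  assert (Ord : forall n m, (N <= n)%nat -> (n <= m)%nat ->
    hardy_norm (hsub w (psum g m) (psum g n)) <= e).
  { intros n m H1 H2. specialize (Nd n (m - n)%nat).
    replace (n + (m - n))%nat with m in Nd by lia.
    assert (B := nonneg_partial_le v m v0 Hv).
    specialize (HN n H1). apply Rabs_def2 in HN. destruct HN. simpl in *. lra. }
  exists N. intros m n Hm Hn. destruct (Nat.le_ge_cases n m) as [H|H].
  - now apply Ord.
  - rewrite hsub_swap. now apply Ord. }
exists l. split.
- apply (hlim_norm_le w (psum g)); [exact Hl|]. intros n.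
  apply Rle_trans with (sum_n v n); [|now apply nonneg_partial_le].
  induction n as [|n IH]; [rewrite sum_O; apply Hg|].
  rewrite sum_n_S. eapply Rle_trans; [apply hardy_norm_plus|]. specialize (Hg (S n)). fold (psum g n). lra.
- intros z. apply is_Cseries_Clim. apply Clim_ext with (2 := hlim_eval w _ _ z Hl).
  intros n. apply psum_eval.
Qed.

Lemma ex_series_poly_geom (r : R) (p : nat) : 0 < r < 1 ->
  ex_series (fun n => (INR n + 1) ^ p * r ^ n).
Proof.
intros Hr.
assert (P : forall n, 0 < (INR n + 1) ^ p * r ^ n).
{ intros n. assert (I := pos_INR n). apply Rmult_lt_0_compat; apply pow_lt; lra. }
apply ex_series_ext with (fun n => Rabs ((INR n + 1) ^ p * r ^ n)).
{ intros n. apply Rabs_pos_eq. left. apply P. }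
apply ex_series_DAlembert with (1 ^ p * r).
- rewrite pow1. lra.
- intros n. apply Rgt_not_eq, P.
- apply is_lim_seq_ext with (fun n => (1 + / INR (S n)) ^ p * r).
  { intros n. rewrite Rabs_pos_eq by (left; apply Rdiv_lt_0_compat; apply P).
    assert (I := pos_INR n). rewrite S_INR.
    replace (1 + / (INR n + 1)) with ((INR n + 1 + 1) / (INR n + 1)) by (field; lra).
    unfold Rdiv at 1. rewrite Rpow_mult_distr, pow_inv. simpl (r ^ S n).
    field. split; [apply pow_nonzero; lra|apply pow_nonzero; lra]. }
  apply is_lim_seq_mult'; [|apply is_lim_seq_const].
  assert (L : is_lim_seq (fun n => 1 + / INR (S n)) 1).
  { replace (Finite 1) with (Finite (1 + 0)) by (f_equal; ring).
    apply is_lim_seq_plus'; [apply is_lim_seq_const|].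
    replace (Finite 0) with (Rbar_inv p_infty) by reflexivity.
    apply is_lim_seq_inv; [|discriminate].
    apply (is_lim_seq_incr_1 INR), is_lim_seq_INR. }
  induction p as [|p IH]; [apply is_lim_seq_const|]. simpl. apply is_lim_seq_mult'; [exact L|].
  apply IH. intros n. assert (I := pos_INR n). apply Rmult_lt_0_compat; apply pow_lt; lra.
Qed.

(** The one-parameter parabolic group, described only in the coordinate [1 / (1 - Cconj zeta z)].
    This coordinate is injective, which yields the group law. *)
Definition shift_group (zeta : C) (P : R -> disk -> disk) : Prop :=
  forall c z, (/ (1 - Cconj zeta * P c z) = / (1 - Cconj zeta * z) + RtoC c * Ci)%C.

Lemma shift_unique (zeta : C) (y z : disk) : Cmod zeta = 1 ->
  (/ (1 - Cconj zeta * y) = / (1 - Cconj zeta * z))%C -> y = z.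
Proof.
intros Hz H. apply disk_eq.
assert (Y := disk_away zeta y Hz). assert (Z := disk_away zeta z Hz).
assert (E : (1 - Cconj zeta * y = 1 - Cconj zeta * z)%C).
{ set (Y' := (1 - Cconj zeta * y)%C) in *. set (Z' := (1 - Cconj zeta * z)%C) in *.
  transitivity (Y' * Z' * / Z')%C; [field; exact Z|]. rewrite <- H. field. exact Y. }
assert (ZZ := Cconj_unit zeta Hz).
transitivity (zeta * (1 - (1 - Cconj zeta * y)))%C.
{ transitivity ((Cconj zeta * zeta) * y)%C; [rewrite ZZ; ring|ring]. }
rewrite E. transitivity ((Cconj zeta * zeta) * z)%C; [ring|rewrite ZZ; ring].
Qed.

Lemma shift_group_add (zeta : C) (P : R -> disk -> disk) (c d : R) (z : disk) :
  Cmod zeta = 1 -> shift_group zeta P -> P c (P d z) = P (c + d) z.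
Proof.
intros Hz HP. apply (shift_unique zeta _ _ Hz). rewrite !HP, RtoC_plus. ring.
Qed.

Lemma shift_group_zero (zeta : C) (P : R -> disk -> disk) (z : disk) :
  Cmod zeta = 1 -> shift_group zeta P -> P 0 z = z.
Proof. intros Hz HP. apply (shift_unique zeta _ _ Hz). rewrite HP. ring. Qed.

Variables (K : nat) (zeta : C) (P : R -> disk -> disk).
Hypothesis Hz : Cmod zeta = 1.
Hypothesis HP : shift_group zeta P.
Hypothesis BP : forall c, comp_bounded w (P c) ((4 * (1 + c ^ 2)) ^ K).

(** Neumann series for [1 - nu C] with [C] the composition with [P a]; it converges because the
    powers of [C] grow polynomially. The series itself is kept in the conclusion, for its values at
    the origin are needed on the unit circle. *)
Lemma shift_resolvent (a : R) (nu : C) : Cmod nu < 1 ->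
  exists S, 0 <= S /\ forall f : hardy w, exists g : hardy w,
    hardy_norm g <= S * hardy_norm f /\
    (forall z, is_Cseries (fun n => nu ^ n * f (P (INR n * a) z))%C (g z)) /\
    (forall z, g z - nu * g (P a z) = f z)%C.
Proof.
intros Hnu. set (r := (1 + Cmod nu) / 2). assert (M0 := Cmod_ge_0 nu).
assert (Hr : 0 < r < 1) by (unfold r; lra).
set (A := (4 * (1 + a ^ 2)) ^ K).
assert (A0 : 0 <= A). { apply pow_le. assert (T := pow2_ge_0 a). lra. }
(* The [n]-th power is composition with [P (n a)], and
   [4 (1 + n^2 a^2) <= 4 (1 + a^2) (n + 1)^2]. *)
set (v := fun n => A * ((INR n + 1) ^ (2 * K) * r ^ n)).
assert (Ev : ex_series v).
{ apply (ex_series_scal A (fun n => (INR n + 1) ^ (2 * K) * r ^ n)).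
  now apply ex_series_poly_geom. }
assert (v0 : forall n, 0 <= v n).
{ intros n. apply Rmult_le_pos; [exact A0|]. assert (I := pos_INR n).
  apply Rmult_le_pos; apply pow_le; lra. }
assert (Kn : forall n, Cmod (nu ^ n) * (4 * (1 + (INR n * a) ^ 2)) ^ K <= v n).
{ intros n. unfold v. rewrite Cmod_pow.
  assert (I := pos_INR n). assert (T := pow2_ge_0 a). assert (T' := pow2_ge_0 (INR n * a)).
  apply Rle_trans with (r ^ n * (A * (INR n + 1) ^ (2 * K))); [|right; ring].
  apply Rmult_le_compat; [apply pow_le; exact M0|apply pow_le; lra| |].
  - apply pow_incr. unfold r; lra.
  - unfold A. rewrite pow_mult, <- Rpow_mult_distr. apply pow_incr. split; [lra|].
    assert (0 <= INR n * a ^ 2) by nra. nra. }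
exists (Series v). split.
{ apply Rle_trans with (2 := nonneg_partial_le v 0 v0 Ev). rewrite sum_O. apply v0. }
intros f.
destruct (functional_choice (fun n (g : hardy w) =>
  (forall z, g z = nu ^ n * f (P (INR n * a) z))%C /\
  hardy_norm g <= v n * hardy_norm f)) as [g Hg].
{ intros n. destruct (BP (INR n * a) f) as [g [E N]].
  exists (hardy_scal w (nu ^ n)%C g). split.
  - intros z. simpl. now rewrite E.
  - rewrite hardy_norm_scal.
    apply Rle_trans with (Cmod (nu ^ n) * ((4 * (1 + (INR n * a) ^ 2)) ^ K * hardy_norm f)).
    + apply Rmult_le_compat_l; [apply Cmod_ge_0|exact N].
    + rewrite <- Rmult_assoc. apply Rmult_le_compat_r; [apply hardy_norm_pos|apply Kn]. }
destruct (hardy_series g (fun n => v n * hardy_norm f)) as [l [Nl Sl]].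
{ intros n. apply Hg. }
{ apply (ex_series_scal_r (hardy_norm f) v Ev). }
assert (Sl' : forall z, is_Cseries (fun n => nu ^ n * f (P (INR n * a) z))%C (l z)).
{ intros z. apply (is_series_ext (V := C_NormedModule)) with (2 := Sl z).
  intros n. apply Hg. }
exists l. split; [|split; [exact Sl'|]].
- eapply Rle_trans; [exact Nl|]. right. apply Series_scal_r.
- intros z.
  assert (L1 := proj1 (is_Cseries_Clim _ _) (Sl' z)).
  assert (L2 := proj1 (is_Cseries_Clim _ _) (Sl' (P a z))).
  apply Clim_S in L1. apply (Clim_scal nu) in L2.
  assert (L3 := Clim_plus _ _ _ _ (Clim_const (f z)) L2).
  assert (E : l z = (f z + nu * l (P a z))%C).
  { apply (Clim_unique _ _ _ L1). apply Clim_ext with (2 := L3). intros n.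
    rewrite Csum_shift. f_equal.
    - simpl. rewrite Rmult_0_l, (shift_group_zero zeta P z Hz HP). ring.
    - rewrite <- Csum_scal. apply Csum_ext. intros k.
      rewrite (shift_group_add zeta P _ _ z Hz HP), S_INR.
      replace (INR k * a + a) with ((INR k + 1) * a) by ring. simpl. ring. }
  rewrite E. ring.
Qed.

(** Iteration gives [nu^n x(P (n a) z) = x z] for all [n]. These are the terms of a convergent
    series, so the constant [x z] is 0. *)
Lemma shift_no_eigenvector (a : R) (nu : C) (x : hardy w) : Cmod nu < 1 ->
  (forall z, x z = nu * x (P a z))%C -> x = hardy_zero w.
Proof.
intros Hnu Hx. apply hardy_ext. intros z. change (x z = RtoC 0).
destruct (shift_resolvent a nu Hnu) as [S [_ HS]]. destruct (HS x) as [g [_ [Hg _]]].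
assert (E : forall n, (nu ^ n * x (P (INR n * a) z))%C = x z).
{ induction n as [|n IH].
  - simpl. rewrite Rmult_0_l, (shift_group_zero zeta P z Hz HP). ring.
  - rewrite <- IH. rewrite (Hx (P (INR n * a) z)).
    rewrite (shift_group_add zeta P _ _ z Hz HP), S_INR.
    replace (a + INR n * a) with ((INR n + 1) * a) by ring. simpl. ring. }
assert (L := proj1 (is_Cseries_Clim _ _) (Hg z)).
assert (L' := Clim_plus _ _ _ _ (Clim_S _ _ L) (Clim_scal (- RtoC 1)%C _ _ L)).
apply (Clim_ext _ (fun _ => x z)) in L'.
- rewrite (Clim_unique _ _ _ (Clim_const (x z)) L'). ring.
- intros n. rewrite Csum_S, E. ring.
Qed.

Variables (b : R) (T : hardy w -> hardy w).
Hypothesis HT : forall f z, T f z = f (P b z).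

Lemma composition_resolvent (mu : C) : Cmod mu <> 1 ->
  (exists S, 0 <= S /\ forall f : hardy w, exists g : hardy w,
    hardy_norm g <= S * hardy_norm f /\ forall z, (T g z - mu * g z = f z)%C) /\
  (forall x : hardy w, (forall z, T x z = mu * x z)%C -> x = hardy_zero w).
Proof.
intros Hmu. destruct (Rlt_le_dec (Cmod mu) 1) as [H|H].
- split.
  (* Inside the circle, [T - mu = T (1 - mu T^-1)] with [T^-1] the composition with [P (- b)]. *)
  + destruct (shift_resolvent (- b) mu H) as [S [S0 HS]].
    set (Q := (4 * (1 + (- b) ^ 2)) ^ K).
    exists (S * Q). split.
    { apply Rmult_le_pos; [exact S0|]. apply pow_le. assert (B2 := pow2_ge_0 (- b)). lra. }
    intros f. destruct (BP (- b) f) as [f' [Ef Nf]]. destruct (HS f') as [g [Ng [_ Eg]]].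
    exists g. split.
    * eapply Rle_trans; [exact Ng|]. rewrite Rmult_assoc. now apply Rmult_le_compat_l.
    * intros z. specialize (Eg (P b z)). rewrite Ef in Eg.
      rewrite !(shift_group_add zeta P _ _ z Hz HP) in Eg.
      replace (- b + b) with 0 in Eg by ring.
      rewrite (shift_group_zero zeta P z Hz HP) in Eg. now rewrite HT.
  + intros x Hx. apply (shift_no_eigenvector (- b) mu x H). intros z.
    rewrite <- Hx, HT, (shift_group_add zeta P _ _ z Hz HP).
    replace (b + - b) with 0 by ring. now rewrite (shift_group_zero zeta P z Hz HP).
- assert (mu0 : mu <> RtoC 0) by (apply Cmod_gt_0; lra).
  assert (Hnu : Cmod (/ mu) < 1).
  { rewrite Cmod_inv by exact mu0. rewrite <- Rinv_1. apply Rinv_lt_contravar; lra. }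
  split.
  (* Outside the circle, [T - mu = - mu (1 - T / mu)]. *)
  + destruct (shift_resolvent b (/ mu)%C Hnu) as [S [S0 HS]].
    exists S. split; [exact S0|]. intros f. destruct (HS f) as [g [Ng [_ Eg]]].
    exists (hardy_scal w (- / mu)%C g). split.
    * rewrite hardy_norm_scal, Cmod_opp. assert (G0 := hardy_norm_pos w g).
      apply Rle_trans with (2 := Ng). nra.
    * intros z. rewrite HT. simpl. rewrite <- Eg. field. exact mu0.
  + intros x Hx. apply (shift_no_eigenvector b (/ mu)%C x Hnu). intros z.
    rewrite <- HT, Hx. field. exact mu0.
Qed.

End Series.

(** * Test functions and the tail estimate *)

Lemma hardy_const (w : weight) : exists f : hardy w, forall z, f z = RtoC 1.
Proof.
set (a := fun k => RtoC (delta0 1 k)).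
destruct (hardy_of_coef w a) as [f Hf].
{ apply (nonneg_series_bounded (term w a) (sum_n (term w a) 0) (term_pos w a)). intros N.
  apply (sum_n_finite_support _ 0 N (term_pos w a)). intros [|k] Hk; [lia|].
  unfold term, a. simpl delta0. rewrite Cmod_0. ring. }
exists f. intros z.
apply (is_Cseries_unique _ _ _ (proj1 (taylor_Cseries _ _) (hardy_taylor f) z)).
rewrite Hf. apply is_Cseries_Clim.
apply Clim_ext with (2 := Clim_const (RtoC 1)). intros n. unfold a. now rewrite Csum_delta0.
Qed.

Lemma hardy_mult_z (w : weight) (f : hardy w) :
  exists g : hardy w, forall z, g z = (disk_val z * f z)%C.
Proof.
destruct (filterlim_bounded (V := R_NormedModule) (fun k => w (S k))) as [B HB].
{ exists 1. apply weight_ratio_lim. }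
set (a := fun k => match k with O => RtoC 0 | S i => hardy_coef f i end).
destruct (hardy_of_coef w a) as [g Hg].
{ apply ex_series_incr_1.
  apply (@ex_series_le R_AbsRing R_CompleteNormedModule _
    (fun k => B ^ 2 * term w (hardy_coef f) k)).
  - intros k. change (Rabs (term w a (S k)) <= B ^ 2 * term w (hardy_coef f) k).
    rewrite Rabs_pos_eq by apply term_pos. unfold term. simpl a. simpl beta.
    assert (P := HB k). change (Rabs (w (S k)) <= B) in P.
    assert (W := weight_pos w (S k) ltac:(lia)). rewrite Rabs_pos_eq in P by lra.
    replace (Cmod (hardy_coef f k) ^ 2 * (beta w k * w (S k)) ^ 2)
      with (w (S k) ^ 2 * (Cmod (hardy_coef f k) ^ 2 * beta w k ^ 2)) by ring.
    apply Rmult_le_compat_r; [apply (term_pos w)|]. apply pow_incr. lra.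
  - apply (ex_series_scal (B ^ 2) (term w (hardy_coef f))), hardy_summable. }
exists g. intros z.
assert (L := proj1 (is_Cseries_Clim _ _) (proj1 (taylor_Cseries _ _) (hardy_taylor g) z)).
assert (L' := proj1 (is_Cseries_Clim _ _) (proj1 (taylor_Cseries _ _) (hardy_taylor f) z)).
apply (Clim_unique _ _ _ (Clim_S _ _ L)).
apply Clim_ext with (2 := Clim_scal (disk_val z) _ _ L'). intros n.
rewrite Hg.
assert (Q : Csum (fun k => a k * disk_val z ^ k)%C (S n) =
  (disk_val z * Csum (fun k => hardy_coef f k * disk_val z ^ k)%C n)%C :> C).
{ rewrite Csum_shift, <- Csum_scal. simpl (a O). rewrite Cmult_0_l, Cplus_0_l.
  apply Csum_ext. intros k. simpl. ring. }
now rewrite Q.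
Qed.

Lemma hardy_pow_one_minus (w : weight) (a : C) (m : nat) :
  exists f : hardy w, forall z, f z = ((1 - a * disk_val z) ^ m)%C.
Proof.
induction m as [|m [f Hf]]; [apply hardy_const|].
destruct (hardy_mult_z w f) as [g Hg].
exists (hsub w f (hardy_scal w a g)). intros z. rewrite hsub_eval.
change (f z - a * g z = (1 - a * z) * (1 - a * z) ^ m)%C.
rewrite Hg, Hf. ring.
Qed.

Lemma sum_inv_sqr (N : nat) : sum_n (fun n => / (INR n + 1) ^ 2) N <= 2 - / (INR N + 1).
Proof.
induction N as [|N IH]; [rewrite sum_O; simpl; lra|].
rewrite sum_n_S, S_INR. assert (I := pos_INR N). set (x := INR N) in *.
assert (/ (x + 1 + 1) ^ 2 <= / (x + 1) - / (x + 1 + 1)); [|lra].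
replace (/ (x + 1) - / (x + 1 + 1)) with (/ ((x + 1) * (x + 1 + 1))) by (field; lra).
apply Rinv_le_contravar; [apply Rmult_lt_0_compat; lra|]. nra.
Qed.

(** One of the [S q] factors is at most [1 / (n^2 b^2)], which is summable, and the other [q]
    together are at most [rho^q < b^2 / 16]. Since the sum of [1 / n^2] is at most 2, this gives
    [1 / 8]. *)
Lemma small_lorentz_tail (b : R) : b <> 0 -> exists p : nat, forall N,
  sum_n (fun n => (/ (1 + ((INR n + 1) * b) ^ 2)) ^ p) N <= 1 / 8.
Proof.
intros Hb. assert (b2 : 0 < b ^ 2) by (assert (b * b > 0) by nra; simpl; lra).
set (rho := / (1 + b ^ 2)).
assert (Hr : 0 < rho < 1).
{ unfold rho. split; [apply Rinv_0_lt_compat; lra|]. rewrite <- Rinv_1.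
  apply Rinv_lt_contravar; lra. }
destruct (pow_lt_1_zero rho) with (y := b ^ 2 / 16) as [q Hq].
{ rewrite Rabs_pos_eq; lra. }
{ lra. }
specialize (Hq q (le_n q)). assert (q0 : 0 < rho ^ q) by now apply pow_lt.
rewrite Rabs_pos_eq in Hq by lra.
exists (S q). intros N.
apply Rle_trans with (sum_n (fun n => / 16 * / (INR n + 1) ^ 2) N).
- apply sum_n_m_le. intros n. assert (I := pos_INR n). set (x := INR n + 1).
  assert (x1 : 1 <= x) by (unfold x; lra).
  assert (x2 : 1 <= x ^ 2) by (apply pow_R1_Rle; exact x1).
  assert (xb : b ^ 2 <= (x * b) ^ 2).
  { rewrite Rpow_mult_distr. apply Rle_trans with (1 * b ^ 2); [lra|].
    apply Rmult_le_compat_r; lra. }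
  rewrite <- tech_pow_Rmult.
  assert (A : / (1 + (x * b) ^ 2) <= / (x ^ 2 * b ^ 2)).
  { apply Rinv_le_contravar; [apply Rmult_lt_0_compat; lra|]. rewrite Rpow_mult_distr. lra. }
  assert (B : (/ (1 + (x * b) ^ 2)) ^ q <= rho ^ q).
  { apply pow_incr. split; [left; apply Rinv_0_lt_compat; lra|].
    apply Rinv_le_contravar; lra. }
  assert (P : 0 < / (1 + (x * b) ^ 2)) by (apply Rinv_0_lt_compat; lra).
  apply Rle_trans with (/ (x ^ 2 * b ^ 2) * (b ^ 2 / 16)).
  + apply Rmult_le_compat; [lra|apply pow_le; lra|exact A|lra].
  + right. field. lra.
- assert (E : sum_n (fun n => / 16 * / (INR n + 1) ^ 2) N =
    / 16 * sum_n (fun n => / (INR n + 1) ^ 2) N :> R).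
  { clear. induction N as [|N IH]; [now rewrite !sum_O|]. rewrite !sum_n_S, IH. ring. }
  rewrite E. assert (S := sum_inv_sqr N).
  assert (0 < / (INR N + 1)) by (apply Rinv_0_lt_compat; assert (I := pos_INR N); lra). lra.
Qed.

(** * From solvability with bounds to a bounded inverse *)

Lemma minus_scal_eval (w : weight) (T : hardy w -> hardy w) (mu : C) (x : hardy w) (z : disk) :
  (minus (T x) (scal mu x) : hardy w) z = (T x z - mu * x z)%C.
Proof. change (T x z + RtoC (-1) * (mu * x z) = T x z - mu * x z)%C. ring. Qed.

(** Solutions are picked by choice, so [B] is a priori only a right inverse. Injectivity makes it
    linear and a left inverse. *)
Lemma bounded_inverse_of_resolvent (w : weight) (T : hardy w -> hardy w) (mu : C) :
  is_linear T ->
  (exists S, 0 <= S /\ forall f : hardy w, exists g : hardy w,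
    hardy_norm g <= S * hardy_norm f /\ forall z, (T g z - mu * g z = f z)%C) ->
  (forall x : hardy w, (forall z, T x z = mu * x z)%C -> x = hardy_zero w) ->
  exists B : hardy w -> hardy w, bounded_inverse (fun x => minus (T x) (scal mu x)) B.
Proof.
intros LT [S [S0 HS]] Inj.
destruct (functional_choice _ HS) as [B HB].
set (A := fun x => minus (T x) (scal mu x) : hardy w).
assert (Ae : forall x z, A x z = (T x z - mu * x z)%C) by (intros; apply minus_scal_eval).
assert (Tp : forall x y z, T (hardy_plus w x y) z = (T x z + T y z)%C).
{ intros x y z. exact (f_equal (fun h : hardy w => h z) (linear_plus T LT x y)). }
assert (Ts : forall k x z, T (hardy_scal w k x) z = (k * T x z)%C).
{ intros k x z. exact (f_equal (fun h : hardy w => h z) (linear_scal T LT k x)). }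
assert (AI : forall x y, (forall z, A x z = A y z) -> x = y).
{ intros x y E. apply hardy_ext. intros z.
  assert (D : hsub w x y = hardy_zero w).
  { apply Inj. intros z'. specialize (E z'). rewrite !Ae in E. unfold hsub, hardy_opp.
    rewrite Tp, Ts.
    change (T x z' + RtoC (-1) * T y z' = mu * (x z' + RtoC (-1) * y z'))%C.
    transitivity ((T x z' - mu * x z') - (T y z' - mu * y z') + mu * (x z' - y z'))%C; [ring|].
    rewrite E. ring. }
  apply (f_equal (fun h : hardy w => h z)) in D. rewrite hsub_eval in D.
  transitivity (x z - y z + y z)%C; [ring|]. rewrite D. simpl. ring. }
assert (AB : forall f z, A (B f) z = f z).
{ intros f z. rewrite Ae. apply HB. }
exists B. split; [|split].
- split.
  + intros x y. apply AI. intros z. rewrite AB, Ae.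
    change (plus (B x) (B y)) with (hardy_plus w (B x) (B y)). rewrite Tp.
    change (x z + y z = T (B x) z + T (B y) z - mu * (B x z + B y z))%C.
    rewrite <- (AB x z), <- (AB y z), !Ae. ring.
  + intros k x. apply AI. intros z. rewrite AB, Ae.
    change (scal k (B x)) with (hardy_scal w k (B x)). rewrite Ts.
    change (k * x z = k * T (B x) z - mu * (k * B x z))%C.
    rewrite <- (AB x z), Ae. ring.
  (* [is_linear] asks for a positive bound, and [S] may be 0. *)
  + exists (S + 1). split; [lra|]. intros x.
    change (hardy_norm (B x) <= (S + 1) * hardy_norm x).
    assert (N := proj1 (HB x)). assert (P := hardy_norm_pos w x). lra.
- intros x. apply AI. intros z. now rewrite AB.
- intros x. apply hardy_ext. intros z. apply AB.
Qed.

(** * The unit circle lies in the spectrum *)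

Section Circle.
Variables (w : weight) (K : nat) (zeta : C) (P : R -> disk -> disk).
Hypothesis Hz : Cmod zeta = 1.
Hypothesis HP : shift_group zeta P.
Hypothesis BP : forall c, comp_bounded w (P c) ((4 * (1 + c ^ 2)) ^ K).
Variables (b : R) (T : hardy w -> hardy w).
Hypothesis Hb : b <> 0.
Hypothesis HT : forall f z, T f z = f (P b z).

(* If [B] inverts [T - lambda], the solutions [x] of [T x - mu x = f] tend to
   [B f] as [mu] tends to [lambda], in particular from both sides of the circle. *)
Lemma resolvent_near (lambda mu : C) (B : hardy w -> hardy w) (M : R) (f x : hardy w) :
  0 <= M ->
  bounded_inverse (fun x => minus (T x) (scal lambda x)) B ->
  (forall y, hardy_norm (B y) <= M * hardy_norm y) ->
  (forall z, T x z - mu * x z = f z)%C ->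
  Cmod (mu - lambda) * M <= 1 / 2 ->
  hardy_norm (hsub w x (B f)) <= 2 * (Cmod (mu - lambda) * M) * hardy_norm (B f).
Proof.
intros M0 [LB [BA AB]] HM Hx Hs.
set (d := (mu - lambda)%C) in *.
assert (E : x = hardy_plus w (B f) (hardy_scal w d (B x))).
{ transitivity (B (hardy_plus w f (hardy_scal w d x))).
  - rewrite <- (BA x) at 1. f_equal. apply hardy_ext. intros z.
    rewrite minus_scal_eval. change (T x z - lambda * x z = f z + d * x z)%C.
    rewrite <- Hx. unfold d. ring.
  - transitivity (hardy_plus w (B f) (B (hardy_scal w d x))); [apply (linear_plus B LB)|].
    f_equal. apply (linear_scal B LB). }
assert (N1 : hardy_norm (hsub w x (B f)) <= Cmod d * M * hardy_norm x).
{ replace (hsub w x (B f)) with (hardy_scal w d (B x)).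
  - rewrite hardy_norm_scal, Rmult_assoc. apply Rmult_le_compat_l; [apply Cmod_ge_0|apply HM].
  - apply hardy_ext. intros z. rewrite hsub_eval.
    assert (Ez := f_equal (fun h : hardy w => h z) E).
    change (x z = B f z + d * B x z)%C in Ez. rewrite Ez.
    change (d * B x z = B f z + d * B x z - B f z)%C. ring. }
assert (N2 := norm_le_hsub w x (B f)).
assert (P0 := hardy_norm_pos w x). assert (P1 := hardy_norm_pos w (hsub w x (B f))).
assert (P2 := hardy_norm_pos w (B f)).
(* As [|d| M <= 1 / 2], half of the norm of [x] is absorbed on the left. *)
assert (N3 : hardy_norm x <= 2 * hardy_norm (B f)) by nra.
assert (Q : 0 <= Cmod d * M) by (apply Rmult_le_pos; [apply Cmod_ge_0|exact M0]).
apply Rle_trans with (1 := N1). nra.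
Qed.

(** The Abel argument in quantitative form, at a single radius [r] close to 1: both resolvents of
    [f] lie within [1 / 8] of [B f], so their values at 0 differ by at most [1 / 4]. The series give
    instead values close to -1 and to 0. *)
Lemma circle_in_spectrum (lambda : C) : Cmod lambda = 1 -> spectrum T lambda.
Proof.
intros Hl [B HB].
assert (HB' := HB). destruct HB' as [[_ _ [M [M0 HM]]] _].
change (forall x, hardy_norm (B x) <= M * hardy_norm x) in HM.
destruct (small_lorentz_tail b Hb) as [p Hp].
(* The origin has coordinate 1, and [P c] moves it to [1 + i c]; the even exponent turns the modulus
   into [(1 + c^2)^(- p)]. *)
destruct (hardy_pow_one_minus w (Cconj zeta) (2 * p)) as [f Hf].
assert (H0 : Cmod (RtoC 0) < 1) by (rewrite Cmod_0; lra).
set (o := exist _ (RtoC 0) H0 : disk).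
assert (fo : f o = RtoC 1).
{ rewrite Hf. simpl disk_val. replace (1 - Cconj zeta * 0)%C with (RtoC 1) by ring.
  clear. induction (2 * p)%nat as [|n IH]; [reflexivity|]. simpl. rewrite IH. ring. }
assert (fP : forall c, Cmod (f (P c o)) = (/ (1 + c ^ 2)) ^ p).
{ intros c. rewrite Hf. assert (E := HP c o).
  replace (/ (1 - Cconj zeta * o))%C with (RtoC 1) in E by (simpl; field).
  set (X := (1 - Cconj zeta * P c o)%C) in *.
  assert (X0 : X <> RtoC 0) by (apply disk_away, Hz).
  rewrite Cmod_pow, pow_mult.
  replace (Cmod X) with (/ Cmod (/ X)).
  - rewrite E, Cmod_one_plus_Ci, pow_inv. rewrite pow2_sqrt; [reflexivity|].
    assert (Q := pow2_ge_0 c). lra.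
  - rewrite Cmod_inv by exact X0. apply Rinv_inv. }
set (N := hardy_norm (B f)). assert (N0 : 0 <= N) by apply hardy_norm_pos.
(* Makes [t], [t M] and [t M N] all at most [1 / 16]. With [r = 1 / (1 + t)] the two spectral
   parameters are at distance [t] and [1 - r <= t] from [lambda]. *)
set (t := / (16 * (1 + M) * (1 + N))).
assert (tp : 0 < t).
{ apply Rinv_0_lt_compat. repeat apply Rmult_lt_0_compat; lra. }
assert (tM : t * (16 * (1 + M) * (1 + N)) = 1).
{ unfold t. field. lra. }
assert (tMN : t * M * N <= 1 / 16 /\ t * M <= 1 / 16 /\ t <= 1 / 16).
{ assert (0 <= t * M) by nra. assert (0 <= t * N) by nra. assert (0 <= t * M * N) by nra.
  lra. }
destruct tMN as [tMN [tM' t1]].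
set (r := / (1 + t)).
assert (r0 : 0 < r) by (apply Rinv_0_lt_compat; lra).
assert (rt : r * (1 + t) = 1) by (unfold r; field; lra).
assert (r1 : r < 1) by nra.
assert (l0 : lambda <> RtoC 0) by (apply Cmod_gt_0; lra).
assert (rC : RtoC r <> RtoC 0).
{ intros F. apply (f_equal fst) in F. simpl in F. lra. }
set (nu := (RtoC r / lambda)%C). set (mu := (RtoC r * lambda)%C).
assert (Hnu : Cmod nu = r).
{ unfold nu. rewrite Cmod_div, Cmod_R, Rabs_pos_eq, Hl by (lra || exact l0). field. }
assert (Hmu : Cmod mu = r).
{ unfold mu. rewrite Cmod_mult, Cmod_R, Rabs_pos_eq, Hl by lra. ring. }
(* Stated for [c = b] and [c = - b] at once: the forward and the backward orbit of the origin have
   the same moduli. *)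
assert (Tail : forall (v : C) (c : R) (N : nat), Cmod v <= 1 -> Rabs c = Rabs b ->
  sum_n (fun n => Cmod (v ^ S n * f (P ((INR n + 1) * c) o))) N <= 1 / 8).
{ intros v c n Hv Hc. apply Rle_trans with (2 := Hp n). apply sum_n_m_le. intros k.
  rewrite Cmod_mult, Cmod_pow, fP.
  replace (((INR k + 1) * c) ^ 2) with (((INR k + 1) * b) ^ 2).
  2: { rewrite !Rpow_mult_distr, <- (pow2_abs c), Hc, pow2_abs. reflexivity. }
  assert (Q := pow2_ge_0 ((INR k + 1) * b)).
  assert (Q' : 0 <= (/ (1 + ((INR k + 1) * b) ^ 2)) ^ p).
  { apply pow_le. left. apply Rinv_0_lt_compat. lra. }
  assert (V : 0 <= Cmod v ^ S k <= 1).
  { assert (V0 := Cmod_ge_0 v). split; [now apply pow_le|].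
    rewrite <- (pow1 (S k)). now apply pow_incr. }
  nra. }
destruct (shift_resolvent w K zeta P Hz HP BP b nu) as [S1 [_ HS1]]; [lra|].
destruct (HS1 f) as [g1 [_ [Sg1 Eg1]]].
destruct (shift_resolvent w K zeta P Hz HP BP (- b) mu) as [S2 [_ HS2]]; [lra|].
destruct (BP (- b) f) as [f' [Ef' _]].
destruct (HS2 f') as [g2 [_ [Sg2 Eg2]]].
assert (G1 : Cmod (g1 o - RtoC 1) <= 1 / 8).
{ assert (L := Clim_S _ _ (proj1 (is_Cseries_Clim _ _) (Sg1 o))).
  apply (Clim_bound _ _ _ _ L). intros n. rewrite Csum_shift.
  simpl INR at 1. rewrite Rmult_0_l, (shift_group_zero zeta P o Hz HP), fo.
  assert (HC : forall x : C, (nu ^ 0 * 1 + x - 1)%C = x) by (intros; simpl; ring).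
  rewrite HC.
  eapply Rle_trans; [apply Cmod_Csum|].
  rewrite (sum_n_ext _ (fun n => Cmod (nu ^ S n * f (P ((INR n + 1) * b) o)))).
  - apply Tail; [lra|reflexivity].
  - intros k. now rewrite S_INR. }
(* The backward series starts from [f o P (- b)], so after multiplication by [mu] it contains only
   terms of the tail and no term [n = 0]. *)
assert (G2 : r * Cmod (g2 o) <= 1 / 8).
{ assert (L := Clim_scal mu _ _ (proj1 (is_Cseries_Clim _ _) (Sg2 o))).
  rewrite <- Hmu, <- Cmod_mult. rewrite <- (Csub_0_r (mu * g2 o)).
  apply (Clim_bound _ _ _ _ L). intros n. rewrite <- Csum_scal.
  rewrite Csub_0_r.
  eapply Rle_trans; [apply Cmod_Csum|].
  rewrite (sum_n_ext _ (fun n => Cmod (mu ^ S n * f (P ((INR n + 1) * - b) o)))).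
  - apply Tail; [lra|apply Rabs_Ropp].
  - intros k. rewrite Ef', (shift_group_add zeta P _ _ o Hz HP).
    replace (- b + INR k * - b) with ((INR k + 1) * - b) by ring.
    f_equal. simpl. ring. }
assert (X1 : hardy_norm (hsub w (hardy_scal w (- nu)%C g1) (B f)) <= 2 * (t * M) * N).
{ assert (D : Cmod (/ nu - lambda) = t).
  { replace (/ nu - lambda)%C with (lambda * RtoC t)%C.
    - rewrite Cmod_mult, Hl, Cmod_R, Rabs_pos_eq by lra. ring.
    - unfold nu. transitivity (lambda / RtoC r - lambda)%C; [|field; now split].
      replace (RtoC t) with (RtoC 1 / RtoC r - RtoC 1)%C; [field; exact rC|].
      rewrite <- RtoC_div, <- RtoC_minus by lra. f_equal. unfold r. field. lra. }
  rewrite <- D. apply resolvent_near; [lra|exact HB|exact HM| |rewrite D; lra].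
  intros z. rewrite HT. change (- nu * g1 (P b z) - / nu * (- nu * g1 z) = f z)%C.
  rewrite <- Eg1. field. intros F. rewrite F, Cmod_0 in Hnu. lra. }
assert (X2 : hardy_norm (hsub w g2 (B f)) <= 2 * (t * M) * N).
{ assert (D : Cmod (mu - lambda) = 1 - r).
  { replace (mu - lambda)%C with (lambda * RtoC (r - 1))%C.
    - rewrite Cmod_mult, Hl, Cmod_R, Rabs_left by lra. ring.
    - unfold mu. rewrite RtoC_minus. ring. }
  assert (rt' : 1 - r <= t) by nra.
  apply Rle_trans with (2 * (Cmod (mu - lambda) * M) * N).
  - apply resolvent_near; [lra|exact HB|exact HM| |rewrite D; nra].
    intros z. rewrite HT. specialize (Eg2 (P b z)).
    rewrite Ef', !(shift_group_add zeta P _ _ z Hz HP) in Eg2.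
    replace (- b + b) with 0 in Eg2 by ring.
    now rewrite (shift_group_zero zeta P z Hz HP) in Eg2.
  - rewrite D. apply Rmult_le_compat_r; [exact N0|]. nra. }
assert (X3 := hsub_triangle w (hardy_scal w (- nu)%C g1) (B f) g2).
rewrite (hsub_swap w (B f) g2) in X3.
assert (X4 := Cmod_at_zero w (hsub w (hardy_scal w (- nu)%C g1) g2) o eq_refl).
rewrite hsub_eval in X4. change (hardy_scal w (- nu)%C g1 o) with (- nu * g1 o)%C in X4.
assert (X5 : Cmod (- nu * g1 o - g2 o) <= 1 / 4) by lra.
assert (Y1 := Cmod_triangle (- nu * g1 o - g2 o) (g2 o)).
replace (- nu * g1 o - g2 o + g2 o)%C with (- nu * g1 o)%C in Y1 by ring.
rewrite Cmod_mult, Cmod_opp, Hnu in Y1.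
assert (Y2 := Cmod_triangle (g1 o) (- (g1 o - 1))).
replace (g1 o + - (g1 o - 1))%C with (RtoC 1) in Y2 by ring.
rewrite Cmod_1, Cmod_opp in Y2.
(* Now [(7 / 8) r <= r |g1(0)| <= 1 / 4 + |g2(0)|] and [r |g2(0)| <= 1 / 8], which is false for
   [r >= 16 / 17]. *)
assert (16 / 17 <= r) by nra.
assert (Y3 := Cmod_ge_0 (g2 o)). nra.
Qed.

End Circle.

(* By [hardy_ext], at most one [T] satisfies [composition_operator phi T]. *)
Theorem theorem3p8 (w : weight) (phi : disk -> disk)
  (Hw : polynomial_growth w) (Hphi : parabolic_disk_automorphism phi) :
  exists T : hardy w -> hardy w,
    composition_operator phi T /\
    is_linear T /\
    forall lambda : C, spectrum T lambda <-> Cmod lambda = 1.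
Proof.
destruct (polynomial_growth_skew w Hw) as [K HK].
destruct (parabolic_normal_form phi Hphi) as [zeta [b [Hz [Hb Hn]]]].
destruct (functional_choice _ (fun c => imaginary_shift w K zeta c HK Hz)) as [P HPB].
assert (HP : shift_group zeta P) by (intros c; apply HPB).
assert (BP : forall c, comp_bounded w (P c) ((4 * (1 + c ^ 2)) ^ K)) by (intros c; apply HPB).
(* Both maps translate the coordinate by [i b], and the coordinate is injective on the disk. *)
assert (E : forall z, phi z = P b z).
{ intros z. apply (shift_unique zeta _ _ Hz). now rewrite HP. }
destruct (functional_choice _ (BP b)) as [T HTB].
assert (HT : forall f z, T f z = f (P b z)) by (intros f; apply HTB).
assert (LT : is_linear T).
{ split.
  - intros x y. apply hardy_ext. intros z. rewrite HT.
    change (x (P b z) + y (P b z) = T x z + T y z)%C. now rewrite !HT.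
  - intros k x. apply hardy_ext. intros z. rewrite HT.
    change (k * x (P b z) = k * T x z)%C. now rewrite HT.
  - exists ((4 * (1 + b ^ 2)) ^ K). split.
    + apply pow_lt. assert (Q := pow2_ge_0 b). lra.
    + intros x. apply HTB. }
exists T. split; [intros f z; now rewrite HT, E|]. split; [exact LT|].
intros lambda. split.
- intros Hs. apply NNPP. intros H. apply Hs.
  destruct (composition_resolvent w K zeta P Hz HP BP b T HT lambda H) as [R1 R2].
  now apply bounded_inverse_of_resolvent.
- now apply (circle_in_spectrum w K zeta P Hz HP BP b T Hb HT).
Qed.
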